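(* (1) For every $n>0$ there exists an oriented knot diagram $D_n$ with exactly two non-trivial extreme Khovanov homology groups $H^{i_1,j_{\max}}(D_n)$ and $H^{i_2,j_{\max}}(D_n)$ such that $i_1-i_2=n-1$. (2) For any $m,n>0$ there exists an oriented knot diagram $D_{m,n}$ with exactly three non-trivial extreme Khovanov homology groups $H^{i_1,j_{\max}}(D_{m,n})$, $H^{i_2,j_{\max}}(D_{m,n})$ and $H^{i_3,j_{\max}}(D_{m,n})$ such that $i_1-i_2=m-1$ and $i_2-i_3=n$.
   Context: Here $m,n$ are integers. Khovanov homology (conventions). Let $D$ be an oriented link diagram with writhe $w$ (number of positive crossings minus number of negative crossings). A state $s$ assigns a label $A$ or $B$ to each crossing; $\sigma(s)$ is the number of $A$-labels minus the number of $B$-labels. Smooth each crossing according to its label ($A$ and $B$ are the usual Kauffman smoothings; at a positive crossing the $A$-smoothing is the oriented one). An enhanced state also assigns a sign $\epsilon=\pm1$ to each of the resulting circles; $\tau(s)$ is the sum of the signs. Put $i(s)=(w-\sigma(s))/2$ and $j(s)=w+i(s)+\tau(s)$. $C^{i,j}(D)$ is the free abelian group on the enhanced states with $i(s)=i$, $j(s)=j$. An enhanced state $t$ is adjacent to $s$ if they are identical except near one crossing, where the label changes from $A$ in $s$ to $B$ in $t$, and signs change by the rules: merging two circles, $(++\to+)$, $(+-\to-)$, $(-+\to-)$; splitting one circle, $(+\to+-)$, $(+\to-+)$, $(-\to--)$. After ordering the crossings, the differential is $d_i(s)=\sum_t(s:t)\,t$ over adjacent $t$, with $(s:t)=(-1)^{r}$,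 $r$ the number of $B$-labelled crossings coming after the changed crossing. Then $H^{i,j}(D)=\ker d_i/\mathrm{im}\, d_{i-1}$. $j_{\max}=j_{\max}(D)$ is the maximum of $j(s)$ over all enhanced states $s$ of $D$; the groups $H^{i,j_{\max}}(D)$ are the (potential) extreme Khovanov homology groups of the diagram $D$. A knot diagram is a diagram of a one-component link. *)

(* Defs.v *)
From HB Require Import structures.
From mathcomp Require Import all_boot all_order all_algebra.
From mathcomp Require Import ring boolp.

Set Implicit Arguments.
Unset Strict Implicit.
Unset Printing Implicit Defensive.

Import Order.TTheory GRing.Theory Num.Theory.
Local Open Scope ring_scope.

(* Oriented link diagrams on the sphere, as planar combinatorial maps.        *)
(* Every crossing v has four ends (v, 0), ..., (v, 3), listed                 *)
(* counterclockwise from the incoming end of the under-strand.  So the        *)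
(* under-strand runs 0 -> 2, and the over-strand runs 3 -> 1 at a positive    *)
(* crossing and 1 -> 3 at a negative one.                                     *)

Definition dart (n : nat) : finType := ('I_n * 'I_4)%type.

Definition turn {n} (d : dart n) : dart n := (d.1, d.2 + 1).

Definition opp_end {n} (d : dart n) : dart n := (d.1, d.2 + 2).

Definition incoming n (positive : pred 'I_n) (d : dart n) : bool :=
  match val d.2 with
  | 0 => true
  | 1 => ~~ positive d.1
  | 2 => false
  | _ => positive d.1
  end.

(* Genus 0 for each connected component: V + F = E + 2 C with V = n and       *)
(* E = 2n.  Faces are the orbits of turn \o glue.                              *)
Definition planar_map n (glue : dart n -> dart n) : Prop :=
  (n + fcard (turn \o glue) predT =
   2 * n + 2 * n_comp [rel x y | (y == glue x) || (y == turn x)] predT)%N.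

(* glue pairs the two ends of each edge; nloops counts the components         *)
(* without crossings.  The order of 'I_ncross is the order of the crossings.  *)
Record link_diagram := LinkDiagram {
  ncross : nat;
  nloops : nat;
  positive : pred 'I_ncross;
  glue : dart ncross -> dart ncross;
  glueK : involutive glue;
  glue_oriented : forall d, incoming positive (glue d) = ~~ incoming positive d;
  glue_planar : planar_map glue
}.

Definition crossing (D : link_diagram) : finType := 'I_(ncross D).

(* Points of a diagram: crossing ends, and one point per crossingless loop.   *)
Definition point (D : link_diagram) : finType :=
  (dart (ncross D) + 'I_(nloops D))%type.

Definition joined D (at_crossing : dart (ncross D) -> dart (ncross D)) :
    rel (point D) :=
  fun x y => match x, y with
  | inl d, inl d' => (d' == glue d) || (d' == at_crossing d)
  | _, _ => false
  end.

Definition ncomponents D : nat := n_comp (@joined D opp_end) predT.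

Definition is_knot D : Prop := ncomponents D = 1%N.

Definition writhe D : int :=
  (#|[set v : crossing D | positive v]|)%:Z
  - (#|[set v : crossing D | ~~ positive v]|)%:Z.

(* false is the label A, true is the label B. *)
Definition state D : finType := {ffun crossing D -> bool}.

(* Turning the over-strand counterclockwise sweeps the regions between the    *)
(* ends 1, 2 and between 3, 0.  The A-smoothing merges these two regions,     *)
(* hence connects 0 - 1 and 2 - 3; the B-smoothing connects 1 - 2 and 3 - 0.  *)
Definition smoothing D (s : state D) (d : dart (ncross D)) : dart (ncross D) :=
  (d.1, if odd d.2 (+) s d.1 then d.2 - 1 else d.2 + 1).

(* The circles of s are the connected components of this relation. *)
Definition strand D (s : state D) : rel (point D) := joined (smoothing s).

(* A sign for each circle, encoded as a sign for each point (true is +1)      *)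
(* which is constant along circles.                                           *)
Definition signs_on_circles D (x : state D * {ffun point D -> bool}) : bool :=
  [forall p, forall q, strand x.1 p q ==> (x.2 p == x.2 q)].

Definition enhanced D : finType :=
  {x : state D * {ffun point D -> bool} | signs_on_circles x}.

Definition label D (s : enhanced D) : state D := (val s).1.
Definition sgn D (s : enhanced D) : point D -> bool := (val s).2.

Definition sigma_deg D (s : enhanced D) : int :=
  (#|[set v | ~~ label s v]|)%:Z - (#|[set v | label s v]|)%:Z.

(* [roots] selects exactly one point on each circle. *)
Definition tau_deg D (s : enhanced D) : int :=
  \sum_(p in roots (strand (label s))) (if sgn s p then 1 else -1).

Definition i_deg D (s : enhanced D) : int :=
  ((writhe D - sigma_deg s) %/ 2)%Z.

Lemma card_split (T : finType) (P : pred T) :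
  (#|[set x | ~~ P x]|)%:Z = (#|T|)%:Z - (#|[set x | P x]|)%:Z.
Proof.
have -> : [set x | ~~ P x] = ~: [set x | P x] by apply/setP=> x; rewrite !inE.
by rewrite -(cardsC [set x | P x]) PoszD addrAC subrr add0r.
Qed.

(* The division in [i_deg] is exact. *)
Lemma i_degE D (s : enhanced D) : i_deg s * 2 = writhe D - sigma_deg s.
Proof.
rewrite /i_deg divzK // /writhe /sigma_deg !card_split.
set p := (#|[set x | positive _]|)%:Z; set b := (#|[set x | label _ _]|)%:Z.
set c := (#|_|)%:Z.
have -> : p - (c - p) - (c - b - b) = (p + b - c) * 2 by ring.
exact: dvdz_mull.
Qed.

Definition j_deg D (s : enhanced D) : int := writhe D + i_deg s + tau_deg s.

Definition all_plus D : state D * {ffun point D -> bool} :=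
  ([ffun=> false], [ffun=> true]).

Lemma all_plusP D : signs_on_circles (all_plus D).
Proof. by apply/forallP=> p; apply/forallP=> q; rewrite !ffunE eqxx implybT. Qed.

Definition enhanced0 D : enhanced D := exist _ (all_plus D) (all_plusP D).

Definition jmax D : int :=
  \big[Num.max/j_deg (enhanced0 D)]_(s : enhanced D) j_deg s.

Lemma j_deg_le_jmax D (s : enhanced D) : j_deg s <= jmax D.
Proof. exact: (le_bigmax _ (@j_deg D) s). Qed.

Lemma jmax_attained D : exists s : enhanced D, j_deg s = jmax D.
Proof.
rewrite /jmax; apply: (big_ind (fun j => exists s, j_deg s = j)); first by exists (enhanced0 D).
- by move=> _ _ [s <-] [t <-]; case: leP => _; [exists t | exists s].
- by move=> s _; exists s.
Qed.

Definition same_circle D (s : enhanced D) : rel (point D) :=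
  connect (strand (label s)).

Definition at_end D (v : crossing D) (k : 'I_4) : point D := inl (v, k).

(* The points of the circles which pass near the crossing v. *)
Definition near D (s : enhanced D) (v : crossing D) (p : point D) : bool :=
  [exists k, same_circle s (at_end v k) p].

Definition merge_rule (a b c : bool) : bool :=
  (a, b, c) \in [:: (true, true, true); (true, false, false);
                    (false, true, false)].

Definition split_rule (a b c : bool) : bool :=
  (a, b, c) \in [:: (true, true, false); (true, false, true);
                    (false, false, false)].

(* If v is labelled A in s, the circles of s near v pass through the ends 0   *)
(* and 2; if v is labelled B in t, so do the circles of t near v.  They merge *)
(* when the ends 0 and 2 lie on distinct circles of s; otherwise, as the      *)
(* diagram is planar, the circle splits.                                      *)
Definition sign_change D (s t : enhanced D) (v : crossing D) : bool :=
  if same_circle s (at_end v 0) (at_end v 2)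
  then split_rule (sgn s (at_end v 0)) (sgn t (at_end v 0)) (sgn t (at_end v 2))
  else merge_rule (sgn s (at_end v 0)) (sgn s (at_end v 2)) (sgn t (at_end v 0)).

Definition adjacent_at D (s t : enhanced D) (v : crossing D) : bool :=
  [&& ~~ label s v, label t v,
      [forall u, (u != v) ==> (label t u == label s u)],
      [forall p, ~~ near s v p ==> (sgn t p == sgn s p)]
    & sign_change s t v].

(* (s : t) if t is adjacent to s, and 0 otherwise; at most one v contributes. *)
Definition incidence D (s t : enhanced D) : int :=
  \sum_(v | adjacent_at s t v)
    (-1) ^+ #|[set u : crossing D | (v < u)%N && label s u]|.

Definition basis D (i j : int) : finType :=
  {s : enhanced D | (i_deg s == i) && (j_deg s == j)}.

Definition chain D (i j : int) : zmodType := {ffun basis D i j -> int}.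

(* The differential for i' = i + 1; keeping i' separate avoids casts between  *)
(* chain D (i - 1 + 1) j and chain D i j.                                     *)
Definition diff D (i i' j : int) (c : chain D i j) : chain D i' j :=
  [ffun t => \sum_s c s * incidence (val s) (val t)].

Lemma diffB D i i' j : {morph @diff D i i' j : x y / x - y}.
Proof.
move=> x y; apply/ffunP=> t; rewrite !ffunE -sumrB; apply: eq_bigr => s _.
by rewrite !ffunE mulrBl.
Qed.

HB.instance Definition _ D i i' j :=
  Algebra.isZmodMorphism.Build (chain D i j) (chain D i' j) (@diff D i i' j)
    (@diffB D i i' j).

Definition is_cycle D i j : {pred chain D i j} :=
  fun c => diff (i + 1) c == 0.

Lemma is_cycle_zmod_closed D i j : zmod_closed (@is_cycle D i j).
Proof.
split; first by rewrite unfold_in /is_cycle raddf0.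
by move=> x y; rewrite !unfold_in /is_cycle => /eqP dx /eqP dy; rewrite raddfB /= dx dy subr0.
Qed.

HB.instance Definition _ D i j :=
  GRing.isZmodClosed.Build _ (@is_cycle D i j) (@is_cycle_zmod_closed D i j).

Record cycles D (i j : int) := Cycle {
  cycle_val :> chain D i j;
  cycle_valP : cycle_val \in @is_cycle D i j
}.

HB.instance Definition _ D i j := [isSub for @cycle_val D i j].
HB.instance Definition _ D i j := [Choice of cycles D i j by <:].
HB.instance Definition _ D i j :=
  [SubChoice_isSubZmodule of cycles D i j by <:].

Definition is_boundary D i j : {pred cycles D i j} :=
  fun z => `[< exists c : chain D (i - 1) j, val z = diff i c >].

Lemma is_boundaryP D i j (z : cycles D i j) :
  reflect (exists c : chain D (i - 1) j, val z = diff i c) (z \in @is_boundary D i j).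
Proof. by rewrite unfold_in; apply: asboolP. Qed.

Lemma is_boundary_zmod_closed D i j : zmod_closed (@is_boundary D i j).
Proof.
split; first by apply/is_boundaryP; exists 0; rewrite !raddf0.
move=> x y /is_boundaryP[a xE] /is_boundaryP[b yE]; apply/is_boundaryP.
by exists (a - b); rewrite !raddfB /= -xE -yE.
Qed.

HB.instance Definition _ D i j :=
  GRing.isZmodClosed.Build _ (@is_boundary D i j)
    (@is_boundary_zmod_closed D i j).

Definition homology D (i j : int) : zmodType :=
  Quotient.quot (@is_boundary D i j).

Definition extreme_homology D (i : int) : zmodType := homology D i (jmax D).

Definition nontrivial (G : zmodType) : Prop := exists x : G, x != 0.

Lemma pi_homology_eq0 D i j (z : cycles D i j) :
  (\pi_(homology D i j)%qT z == 0) = (z \in @is_boundary D i j).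
Proof. by rewrite -[z in RHS]subr0 Quotient.idealrBE pi_zeror. Qed.

Lemma nontrivial_homologyP D i j :
  nontrivial (homology D i j) <->
  exists c : chain D i j,
    diff (i + 1) c = 0 /\ ~ exists b : chain D (i - 1) j, c = diff i b.
Proof.
split=> [[x]|[c [dc nb]]].
  rewrite -[x]reprK pi_homology_eq0 => nb.
  exists (val (repr x)); split; first exact/eqP/(valP (repr x)).
  by move/is_boundaryP; apply/negP.
have cP : c \in @is_cycle D i j by apply/eqP.
exists (\pi_(homology D i j)%qT (Cycle cP)).
by rewrite pi_homology_eq0; apply/negP => /is_boundaryP.
Qed.

(* G is isomorphic to a direct sum of two non-trivial groups. *)
Definition two_summands (G : zmodType) : Prop :=
  exists (A B : zmodType) (f : {additive A * B -> G}),
    [/\ nontrivial A, nontrivial B & bijective f].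

(* Main.v *)
From HB Require Import structures.
Require Import Defs.
From mathcomp Require Import all_boot all_order all_algebra.
From mathcomp Require Import fingroup perm zify ring.

(** Start from a chord diagram on a circle: chords inside and outside the
    circle, such that chords on the same side do not cross.  Double every chord
    and replace each of the resulting arcs by a crossing whose B-smoothing gives
    back the circle.  A strand that crosses over at an arc comes back at the
    parallel one, so the result is a knot diagram, and all its crossings are
    positive ([chord_link], [chord_link_knot]).

    Its all-B state is one circle.  Starting from it, every A-label lowers i by
    one and adds at most one circle, so j is maximal exactly at the states with
    all signs + whose set S of A-labels adds #|S| circles.  Counting cycles of a
    product of transpositions shows that this happens iff no two chords of S are
    interlaced ([ncirclesE]).  Hence the complex in degree j_max is the augmented
    chain complex of the independence complex of the interlacement graph, and
    H^{N - k} is its reduced homology in dimension k - 1, for N crossings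
    ([nontrivial_extreme]).  The two copies of a chord have the same neighbours,
    so one of each pair can be dropped without changing the homology
    ([homology_basis_lows]).

    It remains to find chord diagrams whose interlacement graph has the right
    independence complex.  The tool is [homology_basis_split]: if Y without v
    and its neighbours lies in an acyclic X avoiding v, then the complex on Y is
    the sum of the complex on Y - v and the suspension of the complex on Y
    without v and its neighbours.  Take a flower: hexagons sharing a vertex v.
    Deleting v from a flower with n petals leaves n paths with 5 vertices, which
    contribute 2 to the degree each; deleting also the neighbours of v leaves n
    paths with 3 vertices, which contribute 1 each.  So the degrees are 2 n and
    n + 1, at distance n - 1 ([one_flower_homology]).  For three groups, join the
    centres of two flowers with a and b petals by an edge; splitting at the
    second centre gives the degrees 2 b + 2 a, 2 b + a + 1 and b + 2 a + 1
    ([two_flower_homology]), with the required gaps for a = n + 1, b = m + n. *)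

Set Implicit Arguments.
Unset Strict Implicit.
Unset Printing Implicit Defensive.

Import Order.TTheory GRing.Theory Num.Theory.
Local Open Scope ring_scope.

(** * Homology of independence complexes *)

Section IndependenceComplex.

Variables (V : finType) (e : rel V) (eps : V -> {set V} -> int).

Definition indep (S : {set V}) : bool :=
  [forall u in S, forall v in S, ~~ e u v].

Lemma indepP (S : {set V}) :
  reflect {in S &, forall u v, ~~ e u v} (indep S).
Proof.
apply: (iffP forall_inP) => [H u v uS vS|H u uS]; first exact: (forall_inP (H u uS)).
by apply/forall_inP=> v; apply: H.
Qed.

Lemma indepS (S T : {set V}) : S \subset T -> indep T -> indep S.
Proof.
move=> sST /indepP iT; apply/indepP=> u v uS vS.
by apply: iT; apply: (subsetP sST).
Qed.

(** Chains of the full simplex on V, indexed by vertex sets.  Subcomplexes are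
    singled out by their support, so that all maps between them live on one
    type. *)
Definition schain := {ffun {set V} -> int}.

(** Interior multiplication by v in the exterior algebra on V; [wedge] is the
    exterior multiplication.  The signs are left abstract up to the two
    identities below, which the signs of Khovanov homology satisfy as they
    stand, without a change of basis. *)
Definition contr (v : V) (c : schain) : schain :=
  [ffun T : {set V} => if v \in T then 0 else eps v T * c (v |: T)].

Definition wedge (v : V) (c : schain) : schain :=
  [ffun S : {set V} => if v \in S then eps v (S :\ v) * c (S :\ v) else 0].

Definition boundary (c : schain) : schain := \sum_v contr v c.

Lemma contr_zmod v : zmod_morphism (contr v).
Proof.
move=> x y; apply/ffunP=> T; rewrite !ffunE.
by case: ifP => _; rewrite ?subrr // mulrBr.
Qed.
HB.instance Definition _ v :=
  GRing.isZmodMorphism.Build schain schain (contr v) (contr_zmod v).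

Lemma wedge_zmod v : zmod_morphism (wedge v).
Proof.
move=> x y; apply/ffunP=> T; rewrite !ffunE.
by case: ifP => _; rewrite ?subrr // mulrBr.
Qed.
HB.instance Definition _ v :=
  GRing.isZmodMorphism.Build schain schain (wedge v) (wedge_zmod v).

Lemma boundary_zmod : zmod_morphism boundary.
Proof. by move=> x y; rewrite /boundary -sumrB; apply: eq_bigr => v _; rewrite raddfB. Qed.
HB.instance Definition _ :=
  GRing.isZmodMorphism.Build schain schain boundary boundary_zmod.

Lemma boundaryE (c : schain) (T : {set V}) :
  boundary c T = \sum_(v | v \notin T) eps v T * c (v |: T).
Proof.
rewrite sum_ffunE [RHS]big_mkcond /=; apply: eq_bigr => v _; rewrite ffunE.
by case: (v \in T).
Qed.

Hypothesis eps_sq : forall v (T : {set V}), eps v T * eps v T = 1.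
Hypothesis eps_anti : forall u v (T : {set V}), u != v -> u \notin T -> v \notin T ->
  eps v (u |: T) * eps u T = - (eps u (v |: T) * eps v T).

Lemma contr_anti u v c : contr u (contr v c) = - contr v (contr u c).
Proof.
apply/ffunP=> T; rewrite !ffunE !inE.
have [->|nuv] := eqVneq u v; first by rewrite ?eqxx /= !mulr0 if_same oppr0.
rewrite /=.
case: (boolP (u \in T)) => uT; case: (boolP (v \in T)) => vT; rewrite ?mulr0 ?oppr0 //.
by rewrite setUCA !mulrA [_ * eps v _]mulrC eps_anti // mulNr [eps v T * _]mulrC.
Qed.

Lemma contr_wedge_neq u v c : u != v -> contr u (wedge v c) = - wedge v (contr u c).
Proof.
move=> nuv; apply/ffunP=> T; rewrite !ffunE !inE (eq_sym v u) (negbTE nuv) /=.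
case: (boolP (u \in T)) => uT; case: (boolP (v \in T)) => vT; rewrite ?mulr0 ?oppr0 //.
have -> : (u |: T) :\ v = u |: (T :\ v).
  by apply/setP=> w; rewrite !inE; have [->|] := eqVneq w v; rewrite //= eq_sym (negbTE nuv).
have := @eps_anti u v (T :\ v) nuv; rewrite !inE eqxx (negbTE uT) andbF setD1K //.
move=> /(_ isT isT) /(congr1 (fun x => x * eps u (T :\ v) * eps u T)) E.
rewrite !mulrA; suff -> : eps u T * eps v (u |: T :\ v) = - (eps v (T :\ v) * eps u (T :\ v)) by rewrite mulNr.
have := eps_sq u (T :\ v); have := eps_sq u T; move: E.
move: (eps u _) (eps u _) (eps v _) (eps v _) => a b x y E H1 H2.
transitivity (y * (b * b) * a); first by rewrite H2; ring.
rewrite mulrA E; transitivity (- (x * b * (a * a))); first by ring.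
by rewrite H1; ring.
Qed.

Lemma contr_wedge v c : contr v (wedge v c) + wedge v (contr v c) = c.
Proof.
apply/ffunP=> T; rewrite !ffunE !inE eqxx /=.
case: (boolP (v \in T)) => vT; rewrite ?add0r ?addr0.
  by rewrite mulrA eps_sq mul1r setD1K.
by rewrite setU1K // mulrA eps_sq mul1r.
Qed.

(** All terms of the boundary but [contr v] anticommute with [wedge v], so
    wedging with v contracts the full simplex.  Every homotopy below is built
    from this one. *)
Lemma boundary_wedge v c : boundary (wedge v c) + wedge v (boundary c) = c.
Proof.
rewrite /boundary raddf_sum (bigD1 v) //= [X in _ + X](bigD1 v) //= addrACA contr_wedge.
rewrite -big_split /= big1 ?addr0 // => u nuv.
by rewrite contr_wedge_neq // addNr.
Qed.

Lemma boundary_contr v c : boundary (contr v c) = - contr v (boundary c).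
Proof. by rewrite /boundary raddf_sum -sumrN; apply: eq_bigr => u _; rewrite contr_anti. Qed.

Definition supp (Y : {set V}) (c : schain) : Prop :=
  forall S, c S != 0 -> (S \subset Y) && indep S.

Definition homog (k : int) (c : schain) : Prop :=
  forall S, c S != 0 -> (#|S|)%:Z = k.

Lemma supp_mono (X Y : {set V}) c : X \subset Y -> supp X c -> supp Y c.
Proof. by move=> XY sc S /sc /andP[/subset_trans->]. Qed.

Lemma supp0 Y : supp Y 0. Proof. by move=> S; rewrite ffunE eqxx. Qed.
Lemma suppD Y c d : supp Y c -> supp Y d -> supp Y (c + d).
Proof.
move=> sc sd S; rewrite ffunE; have [-> | /sc //] := eqVneq (c S) 0.
by rewrite add0r => /sd.
Qed.
Lemma suppN Y c : supp Y c -> supp Y (- c).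
Proof. by move=> sc S; rewrite ffunE oppr_eq0 => /sc. Qed.
Lemma suppB Y c d : supp Y c -> supp Y d -> supp Y (c - d).
Proof. by move=> sc sd; apply: suppD => //; apply: suppN. Qed.
Lemma homogD k c d : homog k c -> homog k d -> homog k (c + d).
Proof.
move=> sc sd S; rewrite ffunE; have [-> | /sc //] := eqVneq (c S) 0.
by rewrite add0r => /sd.
Qed.
Lemma homogN k c : homog k c -> homog k (- c).
Proof. by move=> sc S; rewrite ffunE oppr_eq0 => /sc. Qed.
Lemma homogB k c d : homog k c -> homog k d -> homog k (c - d).
Proof. by move=> sc sd; apply: homogD => //; apply: homogN. Qed.
Lemma chain_mulzE (c : schain) (n : int) (S : {set V}) : (c *~ n) S = c S * n.
Proof.
rewrite -mulrzz; case: n => n; rewrite ?NegzE ?mulrNz -?pmulrn ?ffunE ffunMnE //.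
Qed.

Lemma contr_supp v Y c : supp Y c ->
  supp [set u in Y | [&& u != v, ~~ e v u & ~~ e u v]] (contr v c).
Proof.
move=> sc S; rewrite ffunE; case: ifPn => [_|vS]; first by rewrite eqxx.
rewrite mulf_eq0 negb_or => /andP[_ /sc] /andP[/subsetP sY /indepP iS].
apply/andP; split; last by apply/indepP=> a b aS bS; apply: iS; apply: setU1r.
apply/subsetP=> u uS; rewrite inE sY ?setU1r //=; apply/and3P; split=> //.
- by apply: contraNneq vS => <-.
- by apply: iS; rewrite ?setU11 ?setU1r.
- by apply: iS; rewrite ?setU11 ?setU1r.
Qed.

Lemma contr_suppS v Y c : supp Y c -> supp Y (contr v c).
Proof. by move/(@contr_supp v); apply: supp_mono; apply/subsetP=> u; rewrite inE => /andP[]. Qed.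

Lemma boundary_supp Y c : supp Y c -> supp Y (boundary c).
Proof.
move=> sc; rewrite /boundary; elim/big_ind: _ => [|a b|v _]; [exact: supp0|exact: suppD|exact: contr_suppS].
Qed.

Lemma contr_homog v k c : homog k c -> homog (k - 1) (contr v c).
Proof.
move=> hc S; rewrite ffunE; case: ifPn => [_|vS]; first by rewrite eqxx.
rewrite mulf_eq0 negb_or => /andP[_ /hc] <-; rewrite cardsU1 vS /=; lia.
Qed.

Lemma boundary_homog k c : homog k c -> homog (k - 1) (boundary c).
Proof.
move=> hc; rewrite /boundary; elim/big_ind: _ => [S|a b|v _]; [by rewrite ffunE eqxx|exact: homogD|exact: contr_homog].
Qed.

Lemma wedge_homog v k c : homog k c -> homog (k + 1) (wedge v c).
Proof.
move=> hc S; rewrite ffunE; case: ifPn => [vS|_]; last by rewrite eqxx.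
rewrite mulf_eq0 negb_or => /andP[_ /hc] <-; rewrite [in LHS](cardsD1 v) vS; lia.
Qed.

Lemma contr_eq0 v (Y : {set V}) c : v \notin Y -> supp Y c -> contr v c = 0.
Proof.
move=> vY sc; apply/ffunP=> T; rewrite !ffunE; case: ifP => // _.
apply/eqP; rewrite mulf_eq0 orbC; apply/orP; left; apply: contraNT vY => /sc /andP[/subsetP sY _].
by apply: sY; rewrite setU11.
Qed.

Lemma wedge_supp v (Y Z : {set V}) c :
  v \in Y -> {in Z, forall u, [&& u \in Y, ~~ e v u & ~~ e u v]} -> ~~ e v v ->
  supp Z c -> supp Y (wedge v c).
Proof.
move=> vY ZY evv sc S; rewrite ffunE; case: ifPn => [vS|_]; last by rewrite eqxx.
rewrite mulf_eq0 negb_or => /andP[_ /sc] /andP[/subsetP sZ /indepP iS].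
have mS u : u \in S -> u = v \/ u \in S :\ v.
  by move=> uS; rewrite !inE uS andbT; case: (eqVneq u v); [left|right].
apply/andP; split.
  by apply/subsetP=> u /mS[->//|/sZ/ZY/and3P[]].
apply/indepP=> a b /mS[->|aS] /mS[->|bS] //; last exact: iS.
  by have /and3P[] := ZY _ (sZ _ bS).
by have /and3P[] := ZY _ (sZ _ aS).
Qed.

(** The restriction of c to the vertex sets that avoid v. *)
Definition delete (v : V) (c : schain) : schain := c - wedge v (contr v c).

Lemma deleteE v c : delete v c = contr v (wedge v c).
Proof. by rewrite /delete -{1}(contr_wedge v c) addrK. Qed.

Lemma delete_supp v Y c : supp Y c -> supp (Y :\ v) (delete v c).
Proof.
move=> sc S; rewrite deleteE !ffunE; case: ifPn => [_|vS]; first by rewrite eqxx.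
rewrite !inE eqxx /= setU1K // mulrA eps_sq mul1r => /sc /andP[sY ->]; rewrite andbT.
by rewrite subsetD1 sY.
Qed.

(** A deformation retraction of the independence complex on Y onto a free
    complex with zero differential: z are the generators, of degrees l, p the
    coordinates and h the homotopy.  The degree is the number of vertices, one
    more than the dimension.  The maps are carried along, rather than the
    isomorphism class of the homology, because [homology_basis_split] needs
    them. *)
Definition homology_basis (Y : {set V}) (l : seq nat) : Prop :=
  exists (z : nat -> schain) (p : nat -> {additive schain -> int})
         (h : {additive schain -> schain}),
  [/\ forall i, (i < size l)%N ->
        [/\ supp Y (z i), homog (nth 0%N l i)%:Z (z i) & boundary (z i) = 0],
      forall i j, (i < size l)%N -> (j < size l)%N -> p i (z j) = (i == j)%:R,
      forall i c, (i < size l)%N -> supp Y c -> p i (boundary c) = 0 /\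
        (forall k : int, homog k c -> k != (nth 0%N l i)%:Z -> p i c = 0),
      forall c, supp Y c -> supp Y (h c) /\
        (forall k : int, homog k c -> homog (k + 1) (h c))
    & forall c, supp Y c ->
        c = \sum_(i < size l) z i *~ p i c + (boundary (h c) + h (boundary c))].

Definition acyclic Y := homology_basis Y [::].

Hypothesis e_sym : symmetric e.
Hypothesis e_irr : irreflexive e.

(** The link of v in the independence complex on Y is the independence complex
    on this set. *)
Definition link (v : V) (Y : {set V}) : {set V} :=
  [set u in Y | (u != v) && ~~ e v u].

Lemma contr_link v Y c : supp Y c -> supp (link v Y) (contr v c).
Proof.
move/(@contr_supp v); apply: supp_mono; apply/subsetP=> u.
by rewrite !inE => /andP[-> /and3P[-> -> _]].
Qed.

Lemma homology_basis_set0 : homology_basis set0 [:: 0%N].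
Proof.
pose z0 : schain := [ffun S : {set V} => (S == set0)%:R].
pose p0 (c : schain) := c set0.
have p0_zmod : zmod_morphism p0 by move=> a b; rewrite /p0 !ffunE.
pose p0a : {additive schain -> int} :=
  HB.pack p0 (GRing.isZmodMorphism.Build _ _ p0 p0_zmod).
have bd0 c : supp set0 c -> boundary c = 0.
  move=> sc; rewrite /boundary big1 // => v _; by apply: (contr_eq0 _ sc); rewrite inE.
have sz0 : supp set0 z0.
  move=> S; rewrite ffunE; case: (S =P set0) => [-> _|_]; last by rewrite eqxx.
  by rewrite sub0set; apply/indepP=> u; rewrite inE.
exists (fun=> z0), (fun=> p0a), \0; split.
- move=> [|//] _; split=> //; last exact: bd0.
  by move=> S; rewrite ffunE; case: (S =P set0) => [-> _|_]; rewrite ?cards0 ?eqxx.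
- by move=> [|//] [|//] _ _; rewrite /= /p0 ffunE eqxx.
- move=> [|//] c _ sc; rewrite bd0 // raddf0; split=> // k hc /=.
  by have [//|/hc] := eqVneq (c set0) 0; rewrite cards0 => <-; rewrite eqxx.
- move=> c sc; split; first exact: supp0.
  by move=> k _ S; rewrite ffunE eqxx.
- move=> c sc; rewrite raddf0 /= !addr0 big_ord1.
  apply/ffunP=> S; have [->|nS] := eqVneq S set0.
    by rewrite chain_mulzE ffunE eqxx mul1r.
  have [->|/sc] := eqVneq (c S) 0; last by rewrite subset0 (negbTE nS).
  by rewrite chain_mulzE ffunE (negbTE nS) mul0r.
Qed.

(** The complex is a cone with apex v. *)
Lemma acyclic_isolated v (Y : {set V}) :
  v \in Y -> {in Y, forall u, ~~ e v u} -> acyclic Y.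
Proof.
move=> vY iso; exists (fun=> 0), (fun=> \0), (wedge v); split=> //.
- move=> c sc; split; last by move=> k; apply: wedge_homog.
  apply: (wedge_supp vY _ _ sc); last by rewrite e_irr.
  by move=> u uY; rewrite uY (e_sym u v) iso.
- by move=> c _; rewrite big_ord0 add0r boundary_wedge.
Qed.

Lemma delete_homog v k c : homog k c -> homog k (delete v c).
Proof.
move=> hc; apply: homogB => //.
by rewrite -(subrK 1 k); apply/wedge_homog/contr_homog.
Qed.

Lemma delete_id v (Y : {set V}) c : v \notin Y -> supp Y c -> delete v c = c.
Proof. by move=> vY sc; rewrite /delete (contr_eq0 vY sc) raddf0 subr0. Qed.

Lemma contr_wedge_id v (Y : {set V}) c :
  v \notin Y -> supp Y c -> contr v (wedge v c) = c.
Proof. by move=> vY sc; rewrite -deleteE (delete_id vY sc). Qed.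

Lemma boundary_wedgeE v c : boundary (wedge v c) = c - wedge v (boundary c).
Proof. by rewrite -{2}(boundary_wedge v c) addrK. Qed.

Lemma contr_boundary v c : contr v (boundary c) = - boundary (contr v c).
Proof. by rewrite boundary_contr opprK. Qed.

Lemma boundary_delete v c : boundary (delete v c) = delete v (boundary c) - contr v c.
Proof.
by rewrite /delete raddfB /= boundary_wedgeE contr_boundary raddfN opprK opprB /= addrA.
Qed.

(** The complex on Y is the mapping cone of the inclusion of the link of v into
    the complex on Y :\ v.  This inclusion factors through the acyclic complex
    on X, so it is null-homotopic and the cone splits.  Below, [phi] embeds the
    suspended link and [psi] projects onto the complex on Y :\ v; both use the
    contraction h0 of X to correct for the part of the boundary that leads from
    one summand to the other. *)
Lemma homology_basis_split v (Y X : {set V}) l1 l2 :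
  v \in Y -> link v Y \subset X -> X \subset Y :\ v -> acyclic X ->
  homology_basis (Y :\ v) l1 -> homology_basis (link v Y) l2 ->
  homology_basis Y (l1 ++ map S l2).
Proof.
move=> vY LX XYv [z0 [p0 [h0 [_ _ _ h0P h0E]]]].
move=> [z1 [p1 [h1 [z1P d1 p1P h1P h1E]]]] [z2 [p2 [h2 [z2P d2 p2P h2P h2E]]]].
have {}h0E c : supp X c -> c = boundary (h0 c) + h0 (boundary c).
  by move=> sc; rewrite {1}[c]h0E // big_ord0 add0r.
have XY : X \subset Y by apply: subset_trans XYv (subsetDl _ _).
have YvY : Y :\ v \subset Y by apply: subsetDl.
have vYv : v \notin Y :\ v by rewrite !inE eqxx.
have vX : v \notin X by apply: contraNN vYv => /(subsetP XYv).
have vL : v \notin link v Y by rewrite !inE eqxx andbF.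
pose phi : {additive schain -> schain} := wedge v \- h0.
pose psi : {additive schain -> schain} :=
  (idfun \- (wedge v \o contr v)) \+ (h0 \o contr v).
have phiE c : phi c = wedge v c - h0 c by [].
have psiE c : psi c = delete v c + h0 (contr v c) by [].
move: phi psi phiE psiE => phi psi phiE psiE.
have boundary_phi c : supp (link v Y) c -> boundary (phi c) = - phi (boundary c).
  move=> sc; rewrite !phiE raddfB /= opprB.
  rewrite boundary_wedgeE {1}[c]h0E; last exact: supp_mono sc.
  by rewrite addrAC [boundary _ + _]addrC addrK addrC.
have boundary_psi c : supp Y c -> boundary (psi c) = psi (boundary c).
  move=> sc; rewrite !psiE raddfD /= boundary_delete.
  rewrite contr_boundary raddfN /= -addrA; congr (_ + _).
  have sk : supp X (contr v c) by apply: supp_mono LX _; apply: contr_link.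
  by rewrite {1}[contr v c]h0E // opprD addrAC addNr add0r.
have psi_phi c : supp Y c -> c = psi c + phi (contr v c).
  by move=> sc; rewrite psiE phiE /delete addrACA subrr addr0 subrK.
have phi_supp c : supp (link v Y) c -> supp Y (phi c).
  move=> sc; rewrite phiE; apply: suppB.
    apply: (wedge_supp vY _ _ sc); last by rewrite e_irr.
    by move=> u; rewrite !inE => /and3P[-> _ nvu]; rewrite (e_sym u) nvu.
  by apply: supp_mono XY _; apply: (h0P _ _).1; apply: supp_mono LX _.
have phi_homog k c : supp (link v Y) c -> homog k c -> homog (k + 1) (phi c).
  move=> sc hc; rewrite phiE; apply: homogB; first exact: wedge_homog.
  by apply: (h0P _ _).2 => //; apply: supp_mono LX _.
have psi_supp c : supp Y c -> supp (Y :\ v) (psi c).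
  move=> sc; rewrite psiE; apply: suppD; first exact: delete_supp.
  apply: supp_mono XYv _; apply: (h0P _ _).1.
  by apply: supp_mono LX _; apply: contr_link.
have psi_homog k c : supp Y c -> homog k c -> homog k (psi c).
  move=> sc hc; rewrite psiE; apply: homogD; first exact: delete_homog.
  rewrite -(subrK 1 k); apply: (h0P _ _).2; last exact: contr_homog.
  by apply: supp_mono LX _; apply: contr_link.
have psi_id c : supp (Y :\ v) c -> psi c = c.
  by move=> sc; rewrite psiE (delete_id vYv sc) (contr_eq0 vYv sc) raddf0 addr0.
have contr_phi c : supp (link v Y) c -> contr v (phi c) = c.
  move=> sc; rewrite phiE raddfB /= (contr_wedge_id vL sc).
  rewrite (contr_eq0 vX _) ?subr0 //; apply: (h0P _ _).1.
  exact: supp_mono LX _.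
have psi_phi0 c : supp (link v Y) c -> psi (phi c) = 0.
  move=> sc; apply: (addIr (phi (contr v (phi c)))); rewrite -psi_phi ?add0r.
    by rewrite contr_phi.
  exact: phi_supp.
pose n1 := size l1.
exists (fun i => if (i < n1)%N then z1 i else phi (z2 (i - n1)%N)).
pose q1 i : {additive schain -> int} := p1 i \o psi.
pose q2 i : {additive schain -> int} := p2 i \o contr v.
have q1E i c : q1 i c = p1 i (psi c) by [].
have q2E i c : q2 i c = p2 i (contr v c) by [].
move: q1 q2 q1E q2E => q1 q2 q1E q2E.
exists (fun i => if (i < n1)%N then q1 i else q2 (i - n1)%N).
exists ((h1 \o psi) \- (phi \o h2 \o contr v)).
have ltn2 i : (n1 <= i)%N -> (i < size (l1 ++ map S l2))%N -> (i - n1 < size l2)%N.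
  by rewrite size_cat size_map -/n1 => *; lia.
have nthE i : nth 0%N (l1 ++ map S l2) i =
    if (i < n1)%N then nth 0%N l1 i else nth 0%N (map S l2) (i - n1).
  by rewrite nth_cat.
split.
- move=> i ilt; rewrite nthE; case: (ltnP i n1) => hi.
    by have [s1 s2 s3] := z1P i hi; split=> //; apply: supp_mono s1.
  have lt2 := ltn2 _ hi ilt; have [s1 s2 s3] := z2P _ lt2; split.
  + exact: phi_supp.
  + rewrite (nth_map 0%N) // -addn1 PoszD; exact: phi_homog.
  + by rewrite boundary_phi // s3 raddf0 oppr0.
- move=> i j ilt jlt; case: (ltnP i n1) => hi; case: (ltnP j n1) => hj; rewrite ?q1E ?q2E.
  + by have [s1 _ _] := z1P j hj; rewrite psi_id // d1.
  + have [s1 _ _] := z2P _ (ltn2 _ hj jlt); rewrite psi_phi0 // raddf0.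
    by have -> : (i == j) = false by lia.
  + have [s1 _ _] := z1P j hj; rewrite (contr_eq0 vYv s1) raddf0.
    by have -> : (i == j) = false by lia.
  + have [s1 _ _] := z2P _ (ltn2 _ hj jlt).
    rewrite contr_phi // d2 ?ltn2 //.
    by have -> : (i - n1 == j - n1)%N = (i == j) by lia.
- move=> i c ilt sc; rewrite nthE; case: (ltnP i n1) => hi; rewrite ?q1E ?q2E.
    rewrite -boundary_psi //; have [pbd _] := p1P i (psi c) hi (psi_supp _ sc); split=> // k hc.
    by have [_] := p1P i (psi c) hi (psi_supp _ sc); apply; apply: psi_homog.
  have lt2 := ltn2 _ hi ilt; have [pbd phom] := p2P _ (contr v c) lt2 (contr_link sc).
  split; first by rewrite contr_boundary raddfN /= pbd oppr0.
  move=> k hc nk; apply: (phom (k - 1)); first exact: contr_homog.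
  by move: nk; rewrite (nth_map 0%N) //; apply: contra => /eqP; lia.
- move=> c sc; have [a1 a2] := h1P _ (psi_supp _ sc).
  have [b1 b2] := h2P _ (contr_link sc); split=> /=.
    by apply: suppB; [apply: supp_mono a1|apply: phi_supp].
  move=> k hc; apply: homogB; first exact/a2/psi_homog.
  by apply: phi_homog => //; rewrite -{1}(subrK 1 k); apply/b2/contr_homog.
- move=> c sc /=.
  have E1 := h1E _ (psi_supp _ sc).
  have E2 := congr1 phi (h2E _ (contr_link sc)).
  transitivity (psi c + phi (contr v c)); first exact: psi_phi.
  transitivity (\sum_(i < size l1) z1 i *~ p1 i (psi c) +
      (boundary (h1 (psi c)) + h1 (boundary (psi c))) +
      (\sum_(i < size l2) phi (z2 i) *~ p2 i (contr v c) +
      (phi (boundary (h2 (contr v c))) + phi (h2 (boundary (contr v c)))))).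
    rewrite -E1 E2 2!(raddfD phi) (raddf_sum phi); congr (_ + (_ + _)).
    by apply: eq_bigr => i _; rewrite raddfMz.
  rewrite size_cat size_map big_split_ord /= addrACA; congr (_ + _).
    congr (_ + _); apply: eq_bigr => i _; first by rewrite ltn_ord q1E.
    by rewrite ltnNge leq_addr /= addKn q2E.
  rewrite addrACA raddfB /= [boundary (phi _)]boundary_phi; last exact: (h2P _ (contr_link sc)).1.
  by rewrite opprK -boundary_psi // contr_boundary !raddfN /= opprK.
Qed.

Lemma link_sub v (Y : {set V}) : link v Y \subset Y :\ v.
Proof. by apply/subsetP=> u; rewrite !inE => /and3P[-> ->]. Qed.

Lemma homology_basis_delete v (Y : {set V}) l :
  v \in Y -> acyclic (link v Y) -> homology_basis (Y :\ v) l -> homology_basis Y l.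
Proof.
move=> vY acL HY; rewrite -[l]cats0.
exact: (homology_basis_split vY (subxx _) (link_sub v Y) acL HY acL).
Qed.

(** Deleting w leaves u isolated, so the complex is the suspension of the link
    of w. *)
Lemma homology_basis_pendant u w (Y : {set V}) l :
  u \in Y -> w \in Y -> e w u -> {in Y, forall x, x != w -> ~~ e u x} ->
  homology_basis (link w Y) l -> homology_basis Y (map S l).
Proof.
move=> uY wY ewu pend HL.
have acY : acyclic (Y :\ w).
  apply: (@acyclic_isolated u); last by move=> x; rewrite inE in_set1 => /andP[xw /pend->].
  by rewrite !inE uY andbT; apply: contraTneq ewu => ->; rewrite e_irr.
exact: (homology_basis_split wY (link_sub w Y) (subxx _) acY acY HL).
Qed.

(** The link of v is a cone with apex w, so v can be deleted. *)
Lemma homology_basis_twin v w (Y : {set V}) l :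
  v \in Y -> w \in Y -> v != w -> e v =1 e w ->
  homology_basis (Y :\ v) l -> homology_basis Y l.
Proof.
move=> vY wY nvw evw; apply: homology_basis_delete => //.
apply: (@acyclic_isolated w); first by rewrite inE wY eq_sym nvw evw e_irr.
by move=> u; rewrite inE -evw => /and3P[].
Qed.

Section Petal.

Variables (x : nat -> V) (Z : {set V}).
Hypothesis x_inj : forall i j, (i < 5)%N -> (j < 5)%N -> (x i == x j) = (i == j).
Hypothesis x_path : forall i j, (i < 5)%N -> (j < 5)%N ->
  e (x i) (x j) = (i == j.+1) || (j == i.+1).
Hypothesis x_Z : forall i z, (i < 5)%N -> z \in Z -> (z != x i) && ~~ e (x i) z.

Let xZ i : (i < 5)%N -> x i \in Z = false.
Proof. by move=> i5; apply/negP=> /(x_Z i5); rewrite eqxx. Qed.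

(** Each end of the path is pendant: removing the neighbour x 1 of x 0 with its
    neighbours leaves the edge from x 3 to x 4, which is removed in turn, and
    both steps are suspensions. *)
Lemma homology_basis_path5 l :
  homology_basis Z l ->
  homology_basis ([set u in [seq x i | i <- iota 0 5]] :|: Z) (map S (map S l)).
Proof.
move=> HZ.
apply: (@homology_basis_pendant (x 0) (x 1)); rewrite ?inE ?eqxx ?orbT ?x_path //.
  move=> u; rewrite !inE -!orbA => /or4P[|||/or3P[]]; try by move=> /eqP->; rewrite x_path ?x_inj.
  by move=> /(@x_Z 0 u isT)/andP[].
apply: (@homology_basis_pendant (x 4) (x 3)); rewrite ?inE ?eqxx ?orbT ?x_path ?x_inj //.
  move=> u; rewrite !inE -!orbA => /andP[/or4P[|||/or3P[]]]; try by move=> /eqP->; rewrite !x_path ?x_inj ?eqxx.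
  by move=> /(@x_Z 4 u isT)/andP[].
suff -> : link (x 3) (link (x 1) ([set u in [seq x i | i <- iota 0 5]] :|: Z)) = Z by [].
apply/setP=> u; rewrite !inE.
do 5! [case: (u =P x _) => [->|_]; first by rewrite ?xZ // !x_path // !x_inj].
case uZ: (u \in Z) => //=.
by have /andP[_ ->] := @x_Z 1 u isT uZ; have /andP[_ ->] := @x_Z 3 u isT uZ.
Qed.

Lemma homology_basis_path3 l :
  homology_basis Z l ->
  homology_basis ([set u in [seq x i | i <- iota 1 3]] :|: Z) (map S l).
Proof.
move=> HZ.
apply: (@homology_basis_pendant (x 1) (x 2)); rewrite ?inE ?eqxx ?orbT ?x_path //.
  move=> u; rewrite !inE -!orbA => /or4P[]; try by move=> /eqP->; rewrite x_path ?x_inj.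
  by move=> /(@x_Z 1 u isT)/andP[].
suff -> : link (x 2) ([set u in [seq x i | i <- iota 1 3]] :|: Z) = Z by [].
apply/setP=> u; rewrite !inE.
do 3! [case: (u =P x _) => [->|_]; first by rewrite ?xZ // !x_path // !x_inj].
case uZ: (u \in Z) => //=.
by have /andP[_ ->] := @x_Z 2 u isT uZ.
Qed.

(** The pendant vertex x 3 reduces the path to x 0, which is isolated. *)
Lemma acyclic_path4 :
  acyclic ([set u in [seq x i | i <- iota 0 4]] :|: Z).
Proof.
apply: (@homology_basis_pendant (x 3) (x 2) _ [::]); rewrite ?inE ?eqxx ?orbT ?x_path //.
  move=> u; rewrite !inE -!orbA => /or4P[|||/orP[]]; try by move=> /eqP->; rewrite x_path ?x_inj.
  by move=> /(@x_Z 3 u isT)/andP[].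
apply: (@acyclic_isolated (x 0)); first by rewrite !inE !x_inj // x_path.
move=> u; rewrite !inE -!orbA => /andP[/or4P[|||/orP[]]]; try by move=> /eqP->; rewrite !x_path ?x_inj ?eqxx.
by move=> /(@x_Z 0 u isT)/andP[].
Qed.

End Petal.

Section Flower.

Variables (J : eqType) (P : J -> nat -> V).
Hypothesis P_inj : forall j k j' k', (k < 5)%N -> (k' < 5)%N ->
  (P j k == P j' k') = (j == j') && (k == k').
Hypothesis P_adj : forall j k j' k', (k < 5)%N -> (k' < 5)%N ->
  e (P j k) (P j' k') = (j == j') && ((k == k'.+1) || (k' == k.+1)).

Definition apart (Z : {set V}) : Prop :=
  forall j k z, (k < 5)%N -> z \in Z -> (z != P j k) && ~~ e (P j k) z.

Definition petals m n (js : seq J) : {set V} :=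
  [set u in [seq P j k | j <- js, k <- iota m n]].

Lemma petals_cons m n j js :
  petals m n (j :: js) = [set u in [seq P j k | k <- iota m n]] :|: petals m n js.
Proof. by apply/setP=> u; rewrite !inE allpairs_cons mem_cat. Qed.

Lemma petalsP m n js u :
  reflect (exists j k, [/\ j \in js, (m <= k < m + n)%N & u = P j k]) (u \in petals m n js).
Proof.
rewrite inE; apply: (iffP allpairsP) => [[[j k]] /= [js_j]|[j [k [js_j km ->]]]].
  by rewrite mem_iota => km ->; exists j, k.
by exists (j, k); rewrite /= mem_iota.
Qed.

Lemma apart_petals m n j js Z : (m + n <= 5)%N -> j \notin js -> apart Z ->
  forall k z, (k < 5)%N -> z \in petals m n js :|: Z -> (z != P j k) && ~~ e (P j k) z.
Proof.
move=> mn jjs ZP k z k5 /setUP[/petalsP[j' [k' [js_j' km ->]]]|]; last exact: ZP.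
have k'5 : (k' < 5)%N by lia.
have /negbTE jj' : j != j' by apply: contraNneq jjs => ->.
by rewrite P_inj // P_adj // jj' eq_sym jj'.
Qed.

Lemma homology_basis_petals Z js l : uniq js -> apart Z ->
  homology_basis Z l ->
  homology_basis (petals 0 5 js :|: Z) (map (addn (2 * size js)) l).
Proof.
move=> + ZP HZ; elim: js => [_|j js IH /= /andP[jjs ujs]].
  by rewrite /petals set_nil set0U muln0 (eq_map add0n) map_id.
rewrite petals_cons -setUA.
have -> : map (addn (2 * (size js).+1)) l = map S (map S (map (addn (2 * size js)) l)).
  by rewrite -!map_comp; apply: eq_map => i /=; lia.
apply: homology_basis_path5 (IH ujs) => [i k i5 k5|i k i5 k5|k z k5].
- by rewrite P_inj // eqxx.
- by rewrite P_adj // eqxx.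
- exact: apart_petals.
Qed.

Lemma homology_basis_cores Z js l : uniq js -> apart Z ->
  homology_basis Z l ->
  homology_basis (petals 1 3 js :|: Z) (map (addn (size js)) l).
Proof.
move=> + ZP HZ; elim: js => [_|j js IH /= /andP[jjs ujs]].
  by rewrite /petals set_nil set0U (eq_map add0n) map_id.
rewrite petals_cons -setUA.
have -> : map (addn (size js).+1) l = map S (map (addn (size js)) l).
  by rewrite -map_comp; apply: eq_map.
apply: homology_basis_path3 (IH ujs) => [i k i5 k5|i k i5 k5|k z k5].
- by rewrite P_inj // eqxx.
- by rewrite P_adj // eqxx.
- exact: apart_petals.
Qed.

(** Every petal closes up with v to a hexagon.  Deleting v leaves the petals,
    paths with 5 vertices; the link of v consists of their cores, paths with 3
    vertices, and of what the link contains of Z.  The acyclic set needed to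
    split at v is the link together with the end P j 0 of one petal: this turns
    one core into a path with 4 vertices. *)
Lemma homology_basis_flower v Z js l1 l2 :
  js != [::] -> uniq js -> apart Z -> v \notin Z ->
  (forall j k, (k < 5)%N -> (v != P j k) && (e v (P j k) == (k \in [:: 0; 4])%N)) ->
  homology_basis Z l1 -> homology_basis [set z in Z | ~~ e v z] l2 ->
  homology_basis (v |: (petals 0 5 js :|: Z))
    (map (addn (2 * size js)) l1 ++ map S (map (addn (size js)) l2)).
Proof.
case: js => // j js _ /= /andP[jjs ujs] ZP vZ vP H1 H2.
set Z' := [set z in Z | _] in H2.
have Z'P : apart Z' by move=> i k z k5; rewrite inE => /andP[zZ _]; apply: ZP.
have vY : v \notin petals 0 5 (j :: js) :|: Z.
  rewrite inE negb_or vZ andbT; apply/petalsP=> -[i [k [_ k5 vE]]].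
  by have /andP[] := vP i k k5; rewrite vE eqxx.
have linkE : link v (v |: (petals 0 5 (j :: js) :|: Z)) = petals 1 3 (j :: js) :|: Z'.
  apply/setP=> u; rewrite inE in_setU1 in_setU [RHS]in_setU.
  have [->|nuv] /= := eqVneq u v.
    symmetry; apply/negbTE; apply: contra vY.
    rewrite !in_setU => /orP[/petalsP[i [k [ii k5 ->]]]|]; last first.
      by rewrite inE => /andP[-> _]; rewrite orbT.
    by apply/orP; left; apply/petalsP; exists i, k; split=> //; lia.
  apply/idP/idP=> [/andP[/orP[/petalsP[i [k [ii k5 ->]]]|uZ] evu]|/orP[/petalsP[i [k [ii k5 ->]]]|]].
  - apply/orP; left; apply/petalsP; exists i, k; split=> //.
    have /andP[_ /eqP E] := vP i k k5; move: evu; rewrite E !inE; lia.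
  - by apply/orP; right; rewrite inE uZ.
  - have k5' : (k < 5)%N by lia.
    have /andP[_ /eqP->] := vP i k k5'; apply/andP; split; last by rewrite !inE; lia.
    by apply/orP; left; apply/petalsP; exists i, k; split=> //; lia.
  - by rewrite inE => /andP[-> ->]; rewrite orbT.
apply: (@homology_basis_split v _ (P j 0 |: (petals 1 3 (j :: js) :|: Z'))).
- by rewrite setU11.
- by rewrite linkE subsetUr.
- apply/subsetP=> u /setU1P[->|]; last by rewrite -linkE => /(subsetP (link_sub _ _)).
  have /andP[vPj _] := vP j 0%N isT.
  rewrite in_setD1 eq_sym vPj; apply/setU1P; right; apply/setUP; left.
  by apply/petalsP; exists j, 0%N; rewrite mem_head.
- rewrite petals_cons -!setUA.
  have -> : P j 0 |: ([set u in [seq P j k | k <- iota 1 3]] :|: (petals 1 3 js :|: Z')) =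
      [set u in [seq P j k | k <- iota 0 4]] :|: (petals 1 3 js :|: Z').
    by rewrite setUA; congr (_ :|: _); apply/setP=> u; rewrite !inE.
  apply: acyclic_path4 => [i k i5 k5|i k i5 k5|k z k5].
  + by rewrite P_inj // eqxx.
  + by rewrite P_adj // eqxx.
  + exact: apart_petals.
- rewrite setU1K //; apply: (@homology_basis_petals Z (j :: js)) => //=; exact/andP.
- rewrite linkE; apply: (@homology_basis_cores Z' (j :: js)) => //=; exact/andP.
Qed.

End Flower.

End IndependenceComplex.

(** * Circles of the states of a chord diagram *)

Lemma mem_porbitE (T : finType) (p : {perm T}) x y :
  (y \in porbit p x) = fconnect p x y.
Proof.
apply/porbitP/idP => [[i ->]|xy]; first by rewrite permX fconnect_iter.
by exists (findex p x y); rewrite permX iter_findex.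
Qed.

(** The diagrams are defined through connected components, while the effect of
    a transposition on the number of cycles is known for permutations. *)
Lemma fcard_porbits (T : finType) (p : {perm T}) : fcard p predT = #|porbits p|.
Proof.
have symp : connect_sym (frel p) by apply: fconnect_sym; apply: perm_inj.
have rootE x : porbit p (froot p x) = porbit p x.
  by apply/eqP; rewrite eq_porbit_mem porbit_sym mem_porbitE symp connect_root.
rewrite /n_comp_mem.
have -> : porbits p = porbit p @: [set x in froots p].
  apply/setP=> S; apply/imsetP/imsetP=> [[x _ ->]|[x _ ->]]; last by exists x.
  by exists (froot p x); rewrite ?rootE // inE; apply: roots_root.
rewrite card_in_imset => [|x y]; first by apply: eq_card => x; rewrite !inE andbT.
rewrite !inE => /eqP rx /eqP ry /eqP; rewrite eq_porbit_mem porbit_sym mem_porbitE.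
by move=> /(fingraph.rootP symp); rewrite rx ry.
Qed.

Lemma n_comp_connected (T : finType) (e : rel T) x0 :
  connect_sym e -> (forall x, connect e x0 x) -> n_comp e predT = 1%N.
Proof.
move=> sym_e conn; rewrite -(n_comp_connect sym_e x0).
by apply: eq_n_comp_r => x; rewrite !inE /= conn.
Qed.

Section ChordDiagram.

Variables (N : nat) (pi : 'I_N -> 'I_N).
Hypothesis piK : involutive pi.

Definition interlaced (y z : 'I_N) : bool :=
  (minn y (pi y) < z < maxn y (pi y))%N != (minn y (pi y) < pi z < maxn y (pi y))%N.

Lemma pi_eq (y z : 'I_N) : (nat_of_ord (pi y) == pi z) = (nat_of_ord y == z).
Proof. by rewrite !(inj_eq val_inj) (can_eq piK). Qed.

Lemma pi_eq2 (y z : 'I_N) : (nat_of_ord (pi y) == z) = (nat_of_ord y == pi z).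
Proof. by rewrite -{1}(piK z) pi_eq. Qed.

Lemma interlaced_sym : symmetric interlaced.
Proof.
move=> y z; have := pi_eq y z; have := pi_eq2 y z; rewrite /interlaced.
move: (nat_of_ord y) (nat_of_ord z) (nat_of_ord (pi y)) (nat_of_ord (pi z)) => a b c d; lia.
Qed.

Lemma interlaced_irr : irreflexive interlaced.
Proof.
move=> y; rewrite /interlaced.
move: (nat_of_ord y) (nat_of_ord (pi y)) => a b; lia.
Qed.

Lemma interlaced_pil y z : interlaced (pi y) z = interlaced y z.
Proof. by rewrite /interlaced piK minnC maxnC. Qed.

Lemma interlaced_pir y z : interlaced y (pi z) = interlaced y z.
Proof. by rewrite /interlaced piK eq_sym. Qed.

(** The circle carries N chord ends, exchanged by pi.  Every chord is doubled:
    the end y is replaced by the points (y, false) and (y, true), which follow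
    each other in the direction of [fwd], and the crossing y joins (y, false) to
    (pi y, true).  So the crossings y and pi y are the two parallel copies of
    one chord. *)
Definition pos : finType := ('I_N * bool)%type.

Definition place (x : pos) : nat := (2 * x.1 + x.2)%N.
Definition fwd (x : pos) : pos := if x.2 then (ordS x.1, false) else (x.1, true).
Definition bwd (x : pos) : pos := if x.2 then (x.1, false) else (ord_pred x.1, true).
Definition partner (x : pos) : pos := (pi x.1, ~~ x.2).
Definition chord (x : pos) : 'I_N := if x.2 then pi x.1 else x.1.

Lemma place_inj : injective place.
Proof.
move=> [y a] [z b]; rewrite /place /= => E.
have yz : y = z by apply: val_inj => /=; move: E; case: a; case: b => /=; lia.
by congr (_, _) => //; move: E; rewrite yz; case: a; case: b => /=; lia.
Qed.

Lemma place_lt x : (place x < 2 * N)%N.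
Proof. by rewrite /place; have := ltn_ord x.1; case: x.2 => /=; lia. Qed.

Lemma place_next x :
  place (fwd x) = if ((place x).+1 == 2 * N)%N then 0%N else (place x).+1.
Proof.
case: x => y [] /=; rewrite /place /fwd /=; have yN := ltn_ord y.
  have [yE|yE] := eqVneq (nat_of_ord y).+1 N.
    by rewrite yE modnn; case: ifP => // /negbT; lia.
  by rewrite modn_small; [case: ifP; lia | lia].
by case: ifP; lia.
Qed.

Lemma fwdK : cancel fwd bwd.
Proof. by case=> y [] /=; rewrite /bwd /= ?ordSK. Qed.
Lemma bwdK : cancel bwd fwd.
Proof. by case=> y [] /=; rewrite /fwd /= ?ord_predK. Qed.
Lemma partnerK : involutive partner.
Proof. by case=> y b; rewrite /partner /= piK negbK. Qed.
Lemma chord_partner x : chord (partner x) = chord x.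
Proof. by case: x => y []; rewrite /chord /partner /= ?piK. Qed.

Definition endF (y : 'I_N) : pos := (y, false).
Definition endL (y : 'I_N) : pos := (pi y, true).

Lemma chordF y : chord (endF y) = y. Proof. by []. Qed.
Lemma chordL y : chord (endL y) = y. Proof. exact: piK. Qed.
Lemma chordP x : x = endF (chord x) \/ x = endL (chord x).
Proof. by case: x => y []; rewrite /chord /endF /endL /= ?piK; [right|left]. Qed.
Lemma endF_neqL y z : endF y != endL z.
Proof. by apply/eqP => -[]. Qed.

Definition hop (S : {set 'I_N}) (x : pos) : pos :=
  if chord x \in S then partner x else x.

Lemma hopK S : involutive (hop S).
Proof.
move=> x; rewrite /hop; case xS: (chord x \in S); last by rewrite xS.
by rewrite chord_partner xS partnerK.
Qed.

Lemma circle_inj S : injective (fun x => fwd (hop S x)).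
Proof. exact: inj_comp (can_inj fwdK) (can_inj (hopK S)). Qed.

(** The circles of the state whose A-labels are at S, followed in the direction
    of [fwd]: at a point, first cross over if the label there is A, then walk to
    the next point. *)
Definition circle S : {perm pos} := perm (@circle_inj S).

Lemma circleE S x : circle S x = fwd (hop S x).
Proof. by rewrite permE. Qed.

Definition ncircles S : nat := #|porbits (circle S)|.

Lemma circleU1 (S : {set 'I_N}) v : v \notin S ->
  circle (v |: S) = (tperm (endF v) (endL v) * circle S)%g.
Proof.
move=> vS; apply/permP=> x; rewrite permM !circleE; congr fwd.
rewrite /hop in_setU1.
have [xv|xv] /= := eqVneq (chord x) v.
  have [xE|xE] := chordP x; rewrite xE xv ?tpermL ?tpermR ?chordF ?chordL (negbTE vS).
    by rewrite /partner.
  by rewrite /partner /= piK.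
rewrite tpermD // eq_sym; apply: contraNneq xv => ->; first by rewrite chordF.
by rewrite chordL.
Qed.

(** Changing a label multiplies by a transposition, which splits the circle
    through its two points or merges the two circles through them. *)
Lemma ncirclesU1 (S : {set 'I_N}) v : v \notin S ->
  (ncircles (v |: S) + (endF v \notin porbit (circle S) (endL v)).*2 = ncircles S + 1)%N.
Proof.
move=> vS; rewrite /ncircles circleU1 //.
by have := porbits_mul_tperm (circle S) (endF v) (endL v); rewrite endF_neqL.
Qed.

Lemma ncirclesU1_le S v : (ncircles (v |: S) <= (ncircles S).+1)%N.
Proof.
have [vS|vS] := boolP (v \in S); first by rewrite (setUidPr _) ?sub1set.
by have := ncirclesU1 vS; lia.
Qed.

Lemma ncircles_subset (S T : {set 'I_N}) : S \subset T ->
  (ncircles T <= ncircles S + #|T :\: S|)%N.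
Proof.
move En: #|T :\: S| => n; elim: n T En => [|n IH] T En sST.
  move/eqP: En; rewrite cards_eq0 setD_eq0 => sTS.
  by rewrite addn0; have -> : T = S by apply/eqP; rewrite eqEsubset sTS sST.
have /card_gt0P[v vTS] : (0 < #|T :\: S|)%N by rewrite En.
move: (vTS); rewrite inE => /andP[vS vT].
rewrite -{1}(setD1K vT); apply: leq_trans (ncirclesU1_le _ _) _.
rewrite addnS ltnS; apply: IH; last by rewrite subsetD1 sST.
have -> : (T :\ v) :\: S = (T :\: S) :\ v.
  by apply/setP=> u; rewrite !inE andbCA.
by move: En; rewrite (cardsD1 v) vTS => -[].
Qed.

Definition laminar (S : {set 'I_N}) : Prop := forall x y,
  chord x \in S -> chord y \in S ->
  (place x < place y < place (partner x))%N ->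
  (place x < place (partner y) < place (partner x))%N.

Lemma laminar_indep S : indep interlaced S -> laminar S.
Proof.
move=> /indepP iS x y xS yS.
have : ~~ interlaced x.1 y.1.
  have := iS _ _ xS yS; rewrite /chord.
  by case: (x.2); case: (y.2); rewrite ?interlaced_pil ?interlaced_pir.
rewrite /interlaced /place /partner /=.
have := pi_eq x.1 y.1; have := pi_eq2 x.1 y.1.
move: (nat_of_ord x.1) (nat_of_ord y.1) (nat_of_ord (pi x.1)) (nat_of_ord (pi y.1)) => a b c d.
by case: (x.2); case: (y.2) => /=; lia.
Qed.

(** The walk from x either goes to the next point or jumps over a whole chord
    of S.  As no chord crosses the one that is jumped over, what remains of the
    interval is still closed under S, and the walk arrives at y. *)
Lemma laminar_reach S n x y : laminar S -> place y = (place x + n)%N ->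
  (forall z, (place x <= place z < place y)%N -> chord z \in S ->
     (place x <= place (partner z) < place y)%N) ->
  y \in porbit (circle S) x.
Proof.
move=> lamS; elim/ltn_ind: n x => n IH x yE closed_xy.
case: n IH yE => [|n] IH yE.
  have -> : y = x by apply: place_inj; rewrite yE addn0.
  exact: porbit_id.
pose x' := hop S x.
have x'P : (place x <= place x' < place y)%N.
  rewrite /x' /hop; case: ifP => [xS|_]; last by lia.
  by apply: closed_xy => //; lia.
have wE : place (circle S x) = (place x').+1.
  rewrite circleE place_next; case: eqP => // E.
  by have := place_lt y; rewrite -/x' in E; lia.
have <- : porbit (circle S) (circle S x) = porbit (circle S) x.
  by have := porbit_perm (circle S) 1 x; rewrite expg1.
apply: (IH (place y - (place x').+1)%N); rewrite ?wE; try lia.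
move=> z zlt zS.
have pz := closed_xy z; have {}pz : (place x <= place (partner z) < place y)%N.
  by apply: pz => //; lia.
suff : ~~ (place (partner z) <= place x')%N by lia.
apply/negP=> pzx'.
have nzx u : u != partner z -> place (partner z) != place u.
  by move=> nu; apply: contra nu => /eqP/place_inj->.
have [xS|xS] := boolP (chord x \in S); last first.
  move: x'P pzx' zlt; rewrite /x' /hop (negbTE xS) /= => x'P pzx' zlt.
  have /place_inj E : place (partner z) = place x by lia.
  by move: xS; rewrite -E chord_partner zS.
move: x'P pzx' zlt; rewrite /x' /hop xS /= => x'P pzx' zlt.
have n1 : x != partner z by apply: contraTneq zlt => ->; rewrite partnerK; lia.
have n2 : partner x != partner z.
  by apply/eqP=> /(can_inj partnerK) E; move: zlt x'P; rewrite E; lia.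
have := nzx _ n1; have := nzx _ n2 => *.
have := lamS x (partner z) xS; rewrite chord_partner partnerK => /(_ zS); lia.
Qed.

Hypothesis N_gt0 : (0 < N)%N.

Definition pos0 : pos := (Ordinal N_gt0, false).

Lemma circle0_transitive y : y \in porbit (circle set0) pos0.
Proof.
by apply: (@laminar_reach set0 (place y)) => [x z||z _]; rewrite ?inE.
Qed.

(** With all labels B there is a single circle, so walking [fwd] reaches every
    point. *)
Lemma fwd_ind (P : pos -> Prop) :
  P pos0 -> (forall x, P x -> P (fwd x)) -> forall x, P x.
Proof.
move=> P0 Pfwd x; have /porbitP[i ->] := circle0_transitive x.
rewrite permX; elim: i => //= i /Pfwd.
by rewrite circleE /hop inE.
Qed.

Lemma ncircles0 : ncircles set0 = 1%N.
Proof.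
rewrite /ncircles -fcard_porbits (n_comp_connected (x0 := pos0)) // => [|x].
  exact/fconnect_sym/perm_inj.
by rewrite -mem_porbitE circle0_transitive.
Qed.

Lemma ncircles_le S : (ncircles S <= #|S|.+1)%N.
Proof. by have := ncircles_subset (sub0set S); rewrite ncircles0 setD0. Qed.

(** The ends of a chord v of S lie on the same circle of S :\ v, by
    [laminar_reach] for the interval between them; so v adds a circle. *)
Lemma ncircles_indep S : indep interlaced S -> ncircles S = #|S|.+1.
Proof.
move En: #|S| => n; elim: n S En => [|n IH] S En iS.
  by move/eqP: En; rewrite cards_eq0 => /eqP->; apply: ncircles0.
have /card_gt0P[v vS] : (0 < #|S|)%N by rewrite En.
have E : S = v |: (S :\ v) by rewrite setD1K.
have vS' : v \notin S :\ v by rewrite !inE eqxx.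
have iS' : indep interlaced (S :\ v) by apply: indepS iS; apply: subsetDl.
have cS' : ncircles (S :\ v) = n.+1.
  by apply: IH => //; move: En; rewrite (cardsD1 v) vS => -[].
have lamS := laminar_indep iS.
have lamS' := laminar_indep iS'.
suff con : endF v \in porbit (circle (S :\ v)) (endL v).
  by have := ncirclesU1 vS'; rewrite -E con cS' addn0 addn1.
have step x : chord x = v -> (place x < place (partner x))%N ->
    partner x \in porbit (circle (S :\ v)) x.
  move=> xv ltx; apply: (@laminar_reach _ (place (partner x) - place x)%N) => //; first by lia.
  move=> z zlt; rewrite in_setD1 => /andP[nzv zS].
  have nzx : place x != place z by apply: contra nzv => /eqP/place_inj <-; rewrite xv.
  have := lamS x z; rewrite xv => /(_ vS zS); lia.
have pF : partner (endF v) = endL v by [].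
have pL : partner (endL v) = endF v by rewrite -pF partnerK.
have : place (endF v) != place (endL v).
  by apply: contra (endF_neqL v v) => /eqP/place_inj/eqP.
rewrite neq_ltn => /orP[lt|lt].
  by rewrite porbit_sym; have := step (endF v) (chordF v); rewrite pF; apply.
by have := step (endL v) (chordL v); rewrite pL; apply.
Qed.

(** The points strictly after one end of the chord u and up to the other one
    form a union of circles for the A-labels at u alone.  An interlaced v has
    one end there and one end elsewhere, so it merges two circles. *)
Lemma ncircles_pair u v : interlaced u v -> (ncircles [set u; v] <= 1)%N.
Proof.
move=> uv; have nuv : u != v by apply: contraTneq uv => ->; rewrite interlaced_irr.
pose a := minn (place (endF u)) (place (endL u)).
pose b := maxn (place (endF u)) (place (endL u)).
(* Half-open, because crossing over at an end of u is followed by a step. *)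
pose A x := (a < place x <= b)%N.
have neq : place (endF u) != place (endL u).
  by apply: contra (endF_neqL u u) => /eqP/place_inj/eqP.
have bN : (b < 2 * N)%N by rewrite gtn_max !place_lt.
have inA x : A (circle [set u] x) = A x.
  rewrite /A circleE place_next /hop in_set1.
  have [xu|xu] := eqVneq (chord x) u.
    have pF : partner (endF u) = endL u by [].
    have pL : partner (endL u) = endF u by rewrite -pF partnerK.
    have [->|->] := chordP x; rewrite xu ?pF ?pL; move: neq bN; rewrite /a /b;
      move: (place (endF u)) (place (endL u)) => c d; case: ifP; lia.
  have n1 : place x != place (endF u).
    by apply: contra xu => /eqP/place_inj->; rewrite chordF.
  have n2 : place x != place (endL u).
    by apply: contra xu => /eqP/place_inj->; rewrite chordL.
  move: n1 n2 neq bN; rewrite /a /b; have := place_lt x.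
  move: (place (endF u)) (place (endL u)) (place x) => c d r; case: ifP; lia.
have orbA x y : y \in porbit (circle [set u]) x -> A y = A x.
  case/porbitP=> i ->; rewrite permX; elim: i => //= i IH.
  by rewrite inA.
have := @ncirclesU1 [set u] v; rewrite inE eq_sym nuv => /(_ isT).
rewrite setUC; suff -> : endF v \notin porbit (circle [set u]) (endL v).
  by have := ncircles_le [set u]; rewrite cards1 /=; move: (ncircles _) (ncircles _) => c2 c1; lia.
apply/negP=> /orbA; move: uv; rewrite /interlaced /A /a /b /place /endF /endL /=.
have := pi_eq u v; have := pi_eq2 u v.
move: nuv; rewrite -(inj_eq val_inj) /=.
move: (nat_of_ord u) (nat_of_ord v) (nat_of_ord (pi u)) (nat_of_ord (pi v)) => c d f g; lia.
Qed.

Lemma ncirclesE S : (ncircles S == #|S|.+1) = indep interlaced S.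
Proof.
apply/eqP/idP=> [cS|/ncircles_indep //].
apply/indepP=> u v uS vS; apply/negP=> uv.
have sub : [set u; v] \subset S by rewrite subUset !sub1set uS.
have := ncircles_subset sub; have := ncircles_pair uv.
have nuv : u != v by apply: contraTneq uv => ->; rewrite interlaced_irr.
have := cardsID [set u; v] S; rewrite (setIidPr sub) cards2 nuv cS /=.
move: (ncircles _) #|_ :\: _| #|S| => c d f; lia.
Qed.

(** Going back from S to S :\ v loses a circle. *)
Lemma indep_split_circles (S : {set 'I_N}) v : indep interlaced S -> v \in S ->
  endF v \notin porbit (circle S) (endL v).
Proof.
move=> iS vS; have E : S = v |: (S :\ v) by rewrite setD1K.
have vS' : v \notin S :\ v by rewrite !inE eqxx.
have iS' : indep interlaced (S :\ v) by apply: indepS iS; apply: subsetDl.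
have cE : circle (S :\ v) = (tperm (endF v) (endL v) * circle S)%g.
  by rewrite {2}E circleU1 // mulgA tperm2 mul1g.
have := porbits_mul_tperm (circle S) (endF v) (endL v).
rewrite /= -cE endF_neqL -/(ncircles S) -/(ncircles _) !ncircles_indep //.
rewrite [in #|S|](cardsD1 v) vS; case: (_ \notin _) => /=; move: #|_ :\ _| => n; lia.
Qed.

End ChordDiagram.

(** * The knot diagram of a chord diagram *)

Section Diagram.

Variables (N : nat) (pi : 'I_N -> 'I_N) (inner : pred 'I_N).
Hypothesis N_gt0 : (0 < N)%N.
Hypothesis piK : involutive pi.
Hypothesis inner_pi : forall y, inner (pi y) = inner y.
Hypothesis inner_interlaced :
  forall y z, interlaced pi y z -> inner y != inner z.

Local Notation pos := (pos N).
Local Notation partner := (partner pi).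
Local Notation chord := (chord pi).

(** The B-smoothing connects the ends 3 and 0 of a crossing, and the ends 1 and
    2.  At the crossing y the first pair lies at the point (y, false) of the
    circle and the second pair at (pi y, true). *)
Definition circle_point (d : dart N) : pos :=
  match val d.2 with 0 | 3 => (d.1, false) | _ => (pi d.1, true) end.

(** Whether the circle, run through counterclockwise, arrives at the crossing
    by d.  An inner chord is on its left, so it passes from 3 to 0 and from 1 to
    2; at an outer chord it passes in the opposite direction. *)
Definition arriving (d : dart N) : bool := odd d.2 == inner d.1.

Definition dart_at (arr : bool) (x : pos) : dart N :=
  let k : 'I_4 := if x.2 then if arr == inner x.1 then 1 else 2
                  else if arr == inner x.1 then 3 else 0 in
  (chord x, k).

Lemma dart_atK d : dart_at (arriving d) (circle_point d) = d.
Proof.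
case: d => y [[|[|[|[|//]]]] lt4]; rewrite /dart_at /arriving /circle_point /chord /= ?inner_pi ?piK;
  case: (inner y); congr (_, _); exact: val_inj.
Qed.

Lemma circle_pointK a x : circle_point (dart_at a x) = x.
Proof.
case: x => y []; rewrite /circle_point /dart_at /chord /=; case: eqP => _ /=; rewrite ?piK //.
Qed.

Lemma arrivingK a x : arriving (dart_at a x) = a.
Proof.
by case: x => y []; rewrite /arriving /dart_at /chord /= ?inner_pi; case: a; case: (inner y).
Qed.

Definition cglue (d : dart N) : dart N :=
  if arriving d then dart_at false (bwd (circle_point d))
  else dart_at true (fwd (circle_point d)).

Lemma cglue_end a x : cglue (dart_at a x) =
  if a then dart_at false (bwd x) else dart_at true (fwd x).
Proof. by rewrite /cglue arrivingK circle_pointK. Qed.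

Lemma cglueK : involutive cglue.
Proof.
move=> d; rewrite -[d in RHS]dart_atK {2}/cglue.
by case: (arriving d); rewrite cglue_end ?fwdK ?bwdK.
Qed.

Lemma turn_end a x :
  turn (dart_at a x) = dart_at (~~ a) (if a == inner x.1 then x else partner x).
Proof.
by case: x => y []; rewrite /turn /dart_at /chord /partner /= ?inner_pi ?piK;
  case: a; case Ey: (inner y); rewrite /= ?Ey ?inner_pi ?Ey /= ?piK; congr (_, _); apply: val_inj.
Qed.

Lemma opp_end_end a x : opp_end (dart_at a x) = dart_at a (partner x).
Proof.
by case: x => y []; rewrite /opp_end /dart_at /chord /partner /= ?inner_pi ?piK;
  case: a; case: (inner y) => /=; congr (_, _); apply: val_inj.
Qed.

Lemma incoming_end (d : dart N) : incoming xpredT d = ~~ (circle_point d).2.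
Proof. by case: d => y [[|[|[|[|//]]]] lt4]. Qed.

(** With all crossings positive, the ends 0 and 3 are incoming and the ends 1
    and 2 outgoing.  So the incoming ends are those at the points (y, false),
    and glued ends lie at consecutive points. *)
Lemma cglue_oriented d : incoming xpredT (cglue d) = ~~ incoming xpredT d.
Proof.
rewrite !incoming_end /cglue; case: (arriving d); rewrite circle_pointK;
  by case: (circle_point d) => y [].
Qed.

Let pos0 : pos := pos0 N_gt0.
Let fwd_ind := @fwd_ind N pi piK N_gt0.

Definition inside : {set 'I_N} := [set y | inner y].
Definition outside : {set 'I_N} := [set y | ~~ inner y].

Lemma chord_inner x : inner (chord x) = inner x.1.
Proof. by case: x => y []; rewrite /chord /= ?inner_pi. Qed.

(** A face inside the circle is bounded by arriving ends.  It is one of the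
    regions into which the inner chords cut the disk, so its boundary is traced
    by a circle of the state whose A-labels are at the inner chords. *)
Lemma face_inside x :
  turn (cglue (dart_at true x)) = dart_at true (hop pi inside (bwd x)).
Proof.
by rewrite cglue_end turn_end /hop inE chord_inner; case: (inner _).
Qed.

Lemma face_outside x :
  turn (cglue (dart_at false x)) = dart_at false (hop pi outside (fwd x)).
Proof.
by rewrite cglue_end turn_end /hop inE chord_inner; case: (inner _).
Qed.

Lemma dart_at_inj a : injective (dart_at a).
Proof. exact: can_inj (circle_pointK a). Qed.

Lemma turn_inj : injective (@turn N).
Proof.
move=> [y i] [z j] E; have /= -> := congr1 fst E.
by have /= /addIr -> := congr1 snd E.
Qed.

Lemma nfaces_half (a : bool) (h : pos -> dart N) (p : {perm pos}) :
  injective h -> (forall x, arriving (h x) = a) ->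
  (forall d, arriving d = a -> d \in codom h) ->
  (forall x, turn (cglue (h x)) = h (p x)) ->
  n_comp (frel (@turn N \o cglue)) [pred d | arriving d == a] = #|porbits p|.
Proof.
move=> h_inj h_a a_h hp.
have face_inj : injective (@turn N \o cglue) by exact: inj_comp turn_inj (can_inj cglueK).
have cl : fclosed (@turn N \o cglue) [pred d | arriving d == a].
  move=> d _ /= /eqP <-; rewrite !inE.
  by rewrite -[d]dart_atK cglue_end; case E: (arriving d); rewrite turn_end !arrivingK.
rewrite (adjunction_n_comp h (fconnect_sym face_inj) (fconnect_sym (@perm_inj _ p)) cl).
  rewrite -fcard_porbits; apply: eq_n_comp_r => x.
  by rewrite !inE h_a eqxx.
apply: strict_adjunction => //.
- exact/fconnect_sym/perm_inj.
- by apply/subsetP=> d; rewrite inE => /eqP /a_h.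
- by move=> x y _ /=; rewrite hp (inj_eq h_inj).
Qed.

(** There is one face more inside the circle than there are inner chords, and
    likewise outside; this is Euler's formula for the diagram. *)
Lemma nfaces : fcard (@turn N \o cglue) predT = (N + 2)%N.
Proof.
have cl : fclosed (@turn N \o cglue) [pred d | arriving d == true].
  move=> d _ /= /eqP <-; rewrite !inE.
  by rewrite -[d]dart_atK cglue_end; case E: (arriving d); rewrite turn_end !arrivingK.
rewrite (n_compC [pred d | arriving d == true]).
rewrite (nfaces_half (h := dart_at true) (p := (circle piK inside)^-1%g)); first last.
- move=> x; rewrite face_inside; congr dart_at; apply: (@perm_inj _ (circle piK inside)).
  by rewrite permKV circleE hopK // bwdK.
- by move=> d da; rewrite -[d]dart_atK da codom_f.
- by move=> x; rewrite arrivingK.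
- exact: dart_at_inj.
have -> : n_comp (frel (@turn N \o cglue)) [predC [pred d | arriving d == true]]
        = n_comp (frel (@turn N \o cglue)) [pred d | arriving d == false].
  by apply: eq_n_comp_r => d; rewrite !inE; case: arriving.
(* Outside, the next face end is obtained by fwd and then hop; conjugating by
   hop gives the order used in circle. *)
rewrite (nfaces_half (h := dart_at false \o hop pi outside) (p := circle piK outside)); first last.
- by move=> x; rewrite /= face_outside circleE.
- move=> d da; rewrite -[d]dart_atK da -[circle_point d](hopK piK outside).
  exact: (codom_f (dart_at false \o hop pi outside)).
- by move=> x; rewrite arrivingK.
- exact: inj_comp (@dart_at_inj false) (can_inj (hopK piK outside)).
rewrite porbitsV -!/(ncircles _ _) !ncircles_indep //.
- have -> : outside = ~: inside by apply/setP=> y; rewrite !inE.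
  by have := cardsC inside; rewrite card_ord; move: #|inside| #|~: inside| => b c; lia.
- by apply/indepP=> y z; rewrite !inE => yo zo; apply/negP=> /inner_interlaced; rewrite (negbTE yo) (negbTE zo).
- by apply/indepP=> y z; rewrite !inE => yo zo; apply/negP=> /inner_interlaced; rewrite yo zo.
Qed.

Lemma cglue_planar : planar_map cglue.
Proof.
rewrite /planar_map nfaces (n_comp_connected (x0 := dart_at true pos0)).
- by lia.
- have E : [rel x y | (y == cglue x) || (y == turn x)]
      =2 relU (frel cglue) (frel (@turn N)).
    by move=> x y; rewrite /= eq_sym (eq_sym (turn x)).
  move=> x y; rewrite !(eq_connect E).
  exact: relU_sym (fconnect_sym (can_inj cglueK)) (fconnect_sym turn_inj) _ _.
set e := [rel x y | _].
have e_glue d : connect e d (cglue d) by apply: connect1; rewrite /= eqxx.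
have e_turn d : connect e d (turn d) by apply: connect1; rewrite /= eqxx orbT.
have e_across x : connect e (dart_at true x) (dart_at false x).
  have := e_turn (dart_at true x); rewrite turn_end.
  case nx: (inner x.1) => // H; apply: connect_trans H _.
  apply: connect_trans (e_turn _) _; apply: connect_trans (e_turn _) _.
  by rewrite turn_end /= inner_pi nx turn_end /= inner_pi nx partnerK.
have all_true : forall x, connect e (dart_at true pos0) (dart_at true x).
  apply: fwd_ind => [|x cx]; first exact: connect0.
  apply: connect_trans cx _; apply: connect_trans (e_across x) _.
  by have := e_glue (dart_at false x); rewrite cglue_end.
move=> d; rewrite -[d]dart_atK; case: (arriving d) => //.
exact: connect_trans (e_across _).
Qed.

Definition chord_link : link_diagram :=
  @LinkDiagram N 0 xpredT cglue cglueK cglue_oriented cglue_planar.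

Lemma joined_sym (f : dart N -> dart N) :
  involutive f -> symmetric (@joined chord_link f).
Proof.
move=> fK [d|[]//] [d'|[]//] /=; congr (_ || _).
  by rewrite eq_sym (can2_eq cglueK cglueK).
by rewrite eq_sym (can2_eq fK fK).
Qed.

(** The strand changes to the other side of a chord at its first copy and comes
    back at the second one, so it follows the circle and passes through all
    points. *)
Lemma chord_link_knot : is_knot chord_link.
Proof.
rewrite /is_knot /ncomponents.
have oppK : involutive (@opp_end N).
  by move=> d; rewrite -[d]dart_atK !opp_end_end partnerK.
apply: (n_comp_connected (x0 := inl (dart_at true pos0))).
  exact: sym_connect_sym (joined_sym oppK).
set e := joined _.
have e_glue d : connect e (inl d) (inl (cglue d)) by apply: connect1; rewrite /= eqxx.
have e_opp d : connect e (inl d) (inl (opp_end d)) by apply: connect1; rewrite /= eqxx orbT.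
(* Between two copies of a chord the strand runs against the circle, so it is
   at the arriving end of the first copy and at the leaving end of the second. *)
pose sigma x := connect e (inl (dart_at true pos0)) (inl (dart_at (~~ x.2) x)).
have step (x : pos) : ~~ x.2 ->
   [/\ connect e (inl (dart_at true x)) (inl (dart_at true (partner x))),
       connect e (inl (dart_at true x)) (inl (dart_at false (pi x.1, false)))
     & connect e (inl (dart_at true x)) (inl (dart_at false (x.1, true)))].
  case: x => y [] //= _.
  have c1 : connect e (inl (dart_at true (y, false))) (inl (dart_at true (pi y, true))).
    by have := e_opp (dart_at true (y, false)); rewrite opp_end_end.
  have c2 : connect e (inl (dart_at true (y, false))) (inl (dart_at false (pi y, false))).
    apply: connect_trans c1 _.
    by have := e_glue (dart_at true (pi y, true)); rewrite cglue_end.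
  split=> //; apply: connect_trans c2 _.
  by have := e_opp (dart_at false (pi y, false)); rewrite opp_end_end /partner /= piK.
have all_sigma : forall x, sigma x.
  apply: fwd_ind => [|[y []] cx]; first exact: connect0.
    apply: connect_trans cx _ => /=.
    by have := e_glue (dart_at false (y, true)); rewrite cglue_end.
  apply: connect_trans cx _ => /=.
  by have [] := step (y, false) isT.
move=> [d|[]//]; rewrite -[d]dart_atK.
case: (circle_point d) => y b; case: (arriving d); case: b.
- apply: connect_trans (all_sigma (pi y, false)) _.
  by have [+ _ _] := step (pi y, false) isT; rewrite /partner /= piK.
- exact: (all_sigma (y, false)).
- exact: (all_sigma (y, true)).
- apply: connect_trans (all_sigma (pi y, false)) _.
  by have [_ + _] := step (pi y, false) isT; rewrite /= piK.
Qed.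

Local Notation D := chord_link.

Definition Aset (s : state D) : {set 'I_N} := [set v : 'I_N | ~~ s v].

Lemma smoothing_end (s : state D) a x :
  smoothing s (dart_at a x) = dart_at (~~ a) (hop pi (Aset s) x).
Proof.
rewrite /hop inE; case: x => y [];
  rewrite /smoothing /dart_at /chord /partner /= ?inner_pi ?piK;
  case: a; case Ey: (inner y); case: (s _);
  rewrite /= ?Ey ?inner_pi ?Ey /= ?piK; congr (_, _); exact: val_inj.
Qed.

Lemma smoothingK (s : state D) : involutive (smoothing s).
Proof. by move=> d; rewrite -[d]dart_atK !smoothing_end hopK // negbK. Qed.

Lemma strand_sym (s : state D) : connect_sym (strand s).
Proof. exact: sym_connect_sym (joined_sym (smoothingK s)). Qed.

(** The circle leaves the crossing by an end d towards the next point, so on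
    any state circle d lies with the end arriving there. *)
Definition trace (d : dart N) : pos :=
  if arriving d then circle_point d else fwd (circle_point d).

Lemma trace_end a x : trace (dart_at a x) = if a then x else fwd x.
Proof. by rewrite /trace arrivingK circle_pointK. Qed.

Lemma strand_circle (s : state D) (d d' : dart N) :
  connect (strand s) (inl d) (inl d') = (trace d' \in porbit (circle piK (Aset s)) (trace d)).
Proof.
have symp : connect_sym (frel (circle piK (Aset s))) by apply/fconnect_sym/perm_inj.
apply/idP/idP.
  rewrite mem_porbitE => /connectP[p]; elim: p d => [|q p IH] d /=.
    by move=> _ [->]; apply: connect0.
  case: q => [q|[]//] /andP[dq qp] E; apply: connect_trans (IH q qp E).
  case/orP: dq => /eqP->; rewrite -[d]dart_atK; case: (arriving d);
    rewrite ?cglue_end ?smoothing_end !trace_end ?bwdK //=.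
    by apply: connect1; rewrite /= circleE.
  by rewrite symp; apply: connect1; rewrite /= circleE hopK.
set e := strand s.
have e_glue b : connect e (inl b) (inl (cglue b)) by apply: connect1; rewrite /= eqxx.
have e_s b : connect e (inl b) (inl (smoothing s b)) by apply: connect1; rewrite /= eqxx orbT.
have to_trace b : connect e (inl b) (inl (dart_at true (trace b))).
  rewrite -[b]dart_atK; case: (arriving b); rewrite trace_end ?connect0 //.
  by have := e_glue (dart_at false (circle_point b)); rewrite cglue_end.
rewrite mem_porbitE => /connectP[p pp E].
apply: connect_trans (to_trace d) _; rewrite (strand_sym s).
apply: connect_trans (to_trace d') _; rewrite (strand_sym s) E => {E}.
elim: p (trace d) pp => [|x p IH] y /=; first by rewrite connect0.
case/andP=> /eqP <- pp; apply: connect_trans (IH _ pp).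
have := e_s (dart_at true y); rewrite smoothing_end => /connect_trans; apply.
by have := e_glue (dart_at false (hop pi (Aset s) y)); rewrite cglue_end circleE.
Qed.

Lemma n_comp_strand (s : state D) : n_comp (strand s) predT = ncircles piK (Aset s).
Proof.
pose h (x : pos) : point D := inl (dart_at true x).
have symp : connect_sym (frel (circle piK (Aset s))) by apply/fconnect_sym/perm_inj.
rewrite (adjunction_n_comp h (strand_sym s) symp) //.
  by rewrite /ncircles -fcard_porbits; apply: eq_n_comp_r.
split=> [[d|[]//] _|x y _].
  exists (trace d); rewrite /h strand_circle trace_end; exact: porbit_id.
by rewrite /h strand_circle !trace_end mem_porbitE.
Qed.

End Diagram.

(** * The extreme Khovanov complex of a chord diagram *)

Lemma mulrz_pairB (G : zmodType) (a b : G) (x y : int * int) :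
  a *~ (x - y).1 + b *~ (x - y).2 = (a *~ x.1 + b *~ x.2) - (a *~ y.1 + b *~ y.2).
Proof. by rewrite !mulrzBr opprD addrACA. Qed.

Section Extreme.

Variables (N : nat) (pi : 'I_N -> 'I_N) (inner : pred 'I_N).
Hypothesis N_gt0 : (0 < N)%N.
Hypothesis piK : involutive pi.
Hypothesis inner_pi : forall y, inner (pi y) = inner y.
Hypothesis inner_interlaced :
  forall y z, interlaced pi y z -> inner y != inner z.

Local Notation D := (chord_link N_gt0 piK inner_pi inner_interlaced).
Local Notation indep := (indep (interlaced pi)).

Definition A_of (s : enhanced D) : {set 'I_N} := Aset (label s).

Lemma in_A_of (s : enhanced D) v : (v \in A_of s) = ~~ label s v.
Proof. by rewrite inE. Qed.

Lemma writhe_chord : writhe D = N.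
Proof.
rewrite /writhe /=.
have -> : [set v : crossing D | xpredT v] = setT by apply/setP=> v; rewrite !inE.
have -> : [set v : crossing D | ~~ xpredT v] = set0 by apply/setP=> v; rewrite !inE.
by rewrite cards0 subr0 cardsT card_ord.
Qed.

Lemma i_deg_chord (s : enhanced D) : i_deg s = N%:Z - #|A_of s|%:Z.
Proof.
have := i_degE s; have := card_split (label s).
have -> : [set x | ~~ label s x] = A_of s by [].
have -> : #|crossing D| = N by rewrite /= card_ord.
rewrite writhe_chord /sigma_deg -/(A_of s).
have -> : [set v | ~~ label s v] = A_of s by [].
move: #|A_of s| #|_| (i_deg s) => a b i; lia.
Qed.

Lemma card_roots (s : enhanced D) :
  #|[pred p | p \in roots (strand (label s))]| = ncircles piK (A_of s).
Proof.
rewrite -n_comp_strand; apply: eq_card => p.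
by rewrite !inE andbT.
Qed.

Lemma tau_deg_le (s : enhanced D) : tau_deg s <= (ncircles piK (A_of s))%:Z.
Proof.
rewrite -card_roots -sum1_card -natz natr_sum; apply: ler_sum => p _.
by case: ifP.
Qed.

Lemma sgn_connect (s : enhanced D) p q :
  connect (strand (label s)) p q -> sgn s p = sgn s q.
Proof.
case/connectP=> r; elim: r p => [|x r IH] p /=; first by move=> _ ->.
case/andP=> px pr qE; rewrite -(IH x pr qE).
by have /forallP/(_ p)/forallP/(_ x)/implyP/(_ px)/eqP := valP s.
Qed.

Lemma tau_deg_max (s : enhanced D) :
  tau_deg s = (ncircles piK (A_of s))%:Z -> forall p, sgn s p.
Proof.
move=> tauE p.
have rp : fingraph.root (strand (label s)) p \in roots (strand (label s)).
  exact/roots_root/strand_sym.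
rewrite (sgn_connect (connect_root _ _)); apply/negPn/negP=> nr.
have : tau_deg s < (ncircles piK (A_of s))%:Z.
  rewrite -card_roots -sum1_card -natz natr_sum /tau_deg.
  rewrite (bigD1 _ rp) [ltRHS](bigD1 _ rp) /= (negbTE nr).
  apply: ltr_leD => //; apply: ler_sum => q _; by case: ifP.
by rewrite tauE ltxx.
Qed.

Lemma j_deg_chord (s : enhanced D) :
  j_deg s = 2 * N%:Z - #|A_of s|%:Z + tau_deg s.
Proof. by rewrite /j_deg writhe_chord i_deg_chord; ring. Qed.

Definition plus_pair (S : {set 'I_N}) : state D * {ffun point D -> bool} :=
  ([ffun v => v \notin S], [ffun=> true]).

Lemma plus_pairP S : signs_on_circles (plus_pair S).
Proof. by apply/forallP=> p; apply/forallP=> q; rewrite !ffunE eqxx implybT. Qed.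

Definition plus_state (S : {set 'I_N}) : enhanced D := exist _ (plus_pair S) (plus_pairP S).

Lemma A_of_plus S : A_of (plus_state S) = S.
Proof. by apply/setP=> v; rewrite in_A_of ffunE negbK. Qed.

Lemma j_deg_plus S : j_deg (plus_state S) = 2 * N%:Z - #|S|%:Z + (ncircles piK S)%:Z.
Proof.
rewrite j_deg_chord A_of_plus; congr (_ + _).
rewrite -{2}(A_of_plus S) -card_roots -sum1_card -natz natr_sum; apply: eq_bigr => p _.
by rewrite /sgn /= ffunE.
Qed.

(** Every A-label lowers i by one and adds at most one circle, so no state does
    better than the all-B state with its single circle labelled +. *)
Lemma jmax_chord : jmax D = 2 * N%:Z + 1.
Proof.
apply/eqP; rewrite eq_le; apply/andP; split.
  have [s <-] := jmax_attained D; rewrite j_deg_chord.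
  have := tau_deg_le s; have := ncircles_le piK N_gt0 (A_of s).
  move: (ncircles _ _) #|_| (tau_deg s) => a b t; lia.
have := j_deg_le_jmax (plus_state set0); rewrite j_deg_plus cards0 ncircles0 //; lia.
Qed.

Lemma extremeP (s : enhanced D) : j_deg s = jmax D ->
  indep (A_of s) /\ forall p, sgn s p.
Proof.
rewrite jmax_chord j_deg_chord => E.
have := tau_deg_le s; have := ncircles_le piK N_gt0 (A_of s) => l1 l2.
have nE : ncircles piK (A_of s) = #|A_of s|.+1.
  by move: l1 l2 E; move: (ncircles _ _) #|_| (tau_deg s) => a b t; lia.
split; first by rewrite -(ncirclesE piK N_gt0) nE.
by apply: tau_deg_max; move: E; rewrite nE; move: #|_| (tau_deg s) => b t; lia.
Qed.

(** The ends 0 and 2 lie at the two points of the chord v, on circles which the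
    A-smoothing at v has separated. *)
Lemma same_ends (s : enhanced D) v : indep (A_of s) -> v \in A_of s ->
  same_circle s (@at_end D v 0) (@at_end D v 2) = false.
Proof.
move=> iA vA; rewrite /same_circle /at_end strand_circle.
have nFL := indep_split_circles piK N_gt0 iA vA.
rewrite /trace /arriving /circle_point /= -/(endF v) -/(endL pi v).
have c1 := porbit_perm (circle piK (A_of s)) 1 (endF v).
have c2 := porbit_perm (circle piK (A_of s)) 1 (endL pi v).
move: c1 c2; rewrite !expg1 !circleE /hop chordF chordL // vA.
have pF : partner pi (endF v) = endL pi v by [].
have -> : partner pi (endL pi v) = endF v by rewrite -pF partnerK.
rewrite pF => c1 c2; case: (false == inner v).
  by apply/negbTE; rewrite porbit_sym.
by rewrite -eq_porbit_mem c1 c2 eq_porbit_mem; apply/negbTE.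
Qed.

(** The incidence number between the extreme states with A-labels at v |: T and
    at T. *)
Definition ksign (v : 'I_N) (T : {set 'I_N}) : int :=
  (-1) ^+ #|[set u : 'I_N | (v < u)%N && (u \notin T)]|.

Lemma ksign_sq v T : ksign v T * ksign v T = 1.
Proof. by rewrite -expr2 sqrr_sign. Qed.

Lemma ksignU1 u v (T : {set 'I_N}) : u \notin T ->
  ksign v (u |: T) = if (v < u)%N then - ksign v T else ksign v T.
Proof.
move=> uT; rewrite /ksign; case: ifP => vu.
  rewrite [in RHS](cardsD1 u) inE vu uT exprS mulN1r opprK; congr (_ ^+ #|pred_of_set _|).
  by apply/setP=> w; rewrite !inE negb_or andbCA.
congr (_ ^+ #|pred_of_set _|); apply/setP=> w; rewrite !inE negb_or.
by have [->|] := eqVneq w u; rewrite ?vu.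
Qed.

Lemma ksign_anti u v (T : {set 'I_N}) : u != v -> u \notin T -> v \notin T ->
  ksign v (u |: T) * ksign u T = - (ksign u (v |: T) * ksign v T).
Proof.
move=> nuv uT vT; rewrite !ksignU1 //.
by move: nuv; rewrite -(inj_eq val_inj) /= neq_ltn => /orP[uv|vu];
  rewrite ?uv ?vu ltnNge ltnW ?uv ?vu //= ?mulNr ?opprK mulrC.
Qed.

(** All signs are +, and the change at v merges two circles by [same_ends], so
    the sign rule (++ -> +) applies. *)
Lemma adjacent_extreme (s t : enhanced D) (v : crossing D) : j_deg s = jmax D -> j_deg t = jmax D ->
  adjacent_at s t v = (v \notin A_of t) && (A_of s == v |: A_of t).
Proof.
move=> /extremeP[iS sS] /extremeP[iT sT]; apply/idP/andP.
  case/and5P=> vs vt /forallP oth _ _.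
  split; first by rewrite in_A_of negbK.
  apply/eqP/setP=> u; rewrite in_setU1 !in_A_of.
  by have [->|nuv] //= := eqVneq u v; have /implyP/(_ nuv)/eqP-> := oth u.
case=> vt /eqP E.
have vs : v \in A_of s by rewrite E setU11.
apply/and5P; split.
- by rewrite -in_A_of.
- by move: vt; rewrite in_A_of negbK.
- apply/forallP=> u; apply/implyP=> nuv; apply/eqP/negb_inj.
  by rewrite -!in_A_of E in_setU1 (negbTE nuv).
- by apply/forallP=> p; rewrite sS sT implybT.
- by rewrite /sign_change same_ends // !sS !sT.
Qed.

Lemma incidence_extreme (s t : enhanced D) : j_deg s = jmax D -> j_deg t = jmax D ->
  incidence s t = \sum_(v | v \notin A_of t) (A_of s == v |: A_of t)%:R * ksign v (A_of t).
Proof.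
move=> js jt; rewrite /incidence (eq_bigl _ _ (fun v => adjacent_extreme v js jt)).
rewrite big_mkcondr; apply: eq_bigr => v vt.
case: eqP => [E|_]; last by rewrite mul0r.
rewrite mul1r /ksign; congr (_ ^+ #|pred_of_set _|); apply/setP=> u.
rewrite [LHS]inE [RHS]inE; have := congr1 negb (in_A_of s u).
rewrite negbK E in_setU1 => <-.
by have [->|_] //= := eqVneq u v; rewrite ltnn.
Qed.

Section Chains.

Variable i : int.

Lemma basisP (s : basis D i (jmax D)) :
  [/\ j_deg (val s) = jmax D, indep (A_of (val s)),
      #|A_of (val s)|%:Z = N%:Z - i & forall p, sgn (val s) p].
Proof.
have /andP[/eqP is_ /eqP js] := valP s; have [iS sS] := extremeP js; split=> //.
by have := i_deg_chord (val s); rewrite is_; move: #|_| => k; lia.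
Qed.

(** An extreme state is determined by its A-labels, as all its signs are +. *)
Lemma basis_inj : injective (fun s : basis D i (jmax D) => A_of (val s)).
Proof.
move=> s t E; have [_ _ _ sS] := basisP s; have [_ _ _ sT] := basisP t.
apply/val_inj/val_inj; move: E sS sT.
case: (val s) => -[ls gs] ps; case: (val t) => -[lt gt] pt.
rewrite /A_of /label /sgn /= => E sS sT; congr (_, _).
  by apply/ffunP=> v; have /setP/(_ v) := E; rewrite !inE => /negb_inj.
by apply/ffunP=> p; rewrite sS sT.
Qed.

Lemma basis_of S : indep S -> #|S|%:Z = N%:Z - i ->
  exists s : basis D i (jmax D), A_of (val s) = S.
Proof.
move=> iS cS.
have H : (i_deg (plus_state S) == i) && (j_deg (plus_state S) == jmax D).
  rewrite i_deg_chord A_of_plus cS opprB addrC subrK eqxx /=.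
  by rewrite j_deg_plus jmax_chord (ncircles_indep piK N_gt0 iS); apply/eqP; move: #|S| => k; lia.
by exists (exist _ (plus_state S) H); rewrite A_of_plus.
Qed.

Definition to_simplicial (c : chain D i (jmax D)) : schain 'I_N :=
  [ffun S => \sum_(s | A_of (val s) == S) c s].

Definition of_simplicial (c : schain 'I_N) : chain D i (jmax D) :=
  [ffun s => c (A_of (val s))].

Lemma to_simplicial_zmod : zmod_morphism to_simplicial.
Proof.
move=> x y; apply/ffunP=> S; rewrite !ffunE -sumrB.
by apply: eq_bigr => s _; rewrite !ffunE.
Qed.

Lemma of_simplicial_zmod : zmod_morphism of_simplicial.
Proof. by move=> x y; apply/ffunP=> S; rewrite !ffunE. Qed.

HB.instance Definition _ :=
  GRing.isZmodMorphism.Build _ _ to_simplicial to_simplicial_zmod.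
HB.instance Definition _ :=
  GRing.isZmodMorphism.Build _ _ of_simplicial of_simplicial_zmod.

Lemma to_simplicialK : cancel to_simplicial of_simplicial.
Proof.
move=> c; apply/ffunP=> s; rewrite !ffunE (big_pred1 s) // => t.
by rewrite /= (inj_eq basis_inj).
Qed.

Lemma of_simplicialK c : supp (interlaced pi) setT c -> homog (N%:Z - i) c ->
  to_simplicial (of_simplicial c) = c.
Proof.
move=> sc hc; apply/ffunP=> S; rewrite !ffunE.
have [cS0|cS] := eqVneq (c S) 0.
  by rewrite big1 ?cS0 // => s /eqP sE; rewrite ffunE sE.
have /andP[_ iS] := sc S cS; have [s sE] := basis_of iS (hc S cS).
rewrite (eq_bigl (pred1 s)) => [|t]; last by rewrite /= -sE (inj_eq basis_inj).
by rewrite big_pred1_eq ffunE sE.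
Qed.

Lemma to_simplicial_neq0 c S : to_simplicial c S != 0 ->
  exists s : basis D i (jmax D), A_of (val s) = S.
Proof.
have [s /eqP sE _|none] := pickP (fun s : basis D i (jmax D) => A_of (val s) == S).
  by exists s.
by rewrite ffunE big_pred0 ?eqxx.
Qed.

Lemma to_simplicial_supp c : supp (interlaced pi) setT (to_simplicial c).
Proof.
by move=> S /to_simplicial_neq0[s <-]; rewrite subsetT; have [] := basisP s.
Qed.

Lemma to_simplicial_homog c : homog (N%:Z - i) (to_simplicial c).
Proof. by move=> S /to_simplicial_neq0[s <-]; have [] := basisP s. Qed.

End Chains.

(** The differential removes one A-label at a time; any subset of an
    independent set is independent, so no term of the boundary is lost. *)
Lemma diff_of_simplicial i i' c : i' = i + 1 -> supp (interlaced pi) setT c ->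
  diff i' (of_simplicial i c) = of_simplicial i' (boundary ksign c).
Proof.
move=> i'E sc; apply/ffunP=> t; rewrite !ffunE boundaryE.
have [jt it ct st] := basisP t.
transitivity (\sum_(s : basis D i (jmax D)) \sum_(v | v \notin A_of (val t))
   (A_of (val s) == v |: A_of (val t))%:R * (ksign v (A_of (val t)) * c (v |: A_of (val t)))).
  apply: eq_bigr => s _; have [js _ _ _] := basisP s.
  rewrite incidence_extreme // mulr_sumr; apply: eq_bigr => v _; rewrite ffunE.
  by case: eqP => [->|_]; rewrite ?mul0r ?mulr0 // !mul1r mulrC.
rewrite exchange_big; apply: eq_bigr => v vt /=; rewrite -mulr_suml.
have [->|cv] := eqVneq (c (v |: A_of (val t))) 0; first by rewrite !mulr0.
have /andP[_ iv] := sc _ cv.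
have [|s sE] := basis_of (i := i) iv.
  by rewrite cardsU1 vt /=; move: ct i'E; move: #|_| => k; lia.
rewrite (bigD1 s) //= sE eqxx big1 ?addr0 ?mul1r // => r nrs.
by rewrite -sE (inj_eq (@basis_inj i)) (negbTE nrs).
Qed.

Section Homology.

Variable l : seq nat.
Hypothesis basis_l : homology_basis (interlaced pi) ksign setT l.

Lemma cycle_to_simplicial i (c : chain D i (jmax D)) :
  diff (i + 1) c = 0 -> boundary ksign (to_simplicial c) = 0.
Proof.
move=> dc; have sc := @to_simplicial_supp i c; have hc := @to_simplicial_homog i c.
rewrite -(of_simplicialK (i := i + 1) (c := boundary ksign (to_simplicial c))).
- by rewrite -(diff_of_simplicial (i := i)) // to_simplicialK dc raddf0.
- exact: boundary_supp.
- by rewrite opprD addrA; apply: boundary_homog.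
Qed.

Lemma to_simplicial_boundary i (b : chain D (i - 1) (jmax D)) :
  to_simplicial (diff i b) = boundary ksign (to_simplicial b).
Proof.
have sb := @to_simplicial_supp _ b; have hb := @to_simplicial_homog _ b.
rewrite -{1}(to_simplicialK b) (diff_of_simplicial (i' := i)) ?subrK //.
rewrite of_simplicialK //; first exact: boundary_supp.
have E : N%:Z - i = N%:Z - (i - 1) - 1 by lia.
by rewrite E; apply: boundary_homog hb.
Qed.

Lemma nontrivial_extreme i :
  nontrivial (extreme_homology D i) <-> i \in [seq N%:Z - k%:Z | k <- l].
Proof.
have [z [p [h [zP d pP hP hE]]]] := basis_l.
rewrite nontrivial_homologyP; split=> [[c [dc nb]]|/mapP[k /(nthP 0%N)[a al <-] ->]].
  apply/negPn/negP=> il; apply: nb.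
  have sc := @to_simplicial_supp i c; have hc := @to_simplicial_homog i c.
  exists (of_simplicial (i - 1) (h (to_simplicial c))).
  rewrite (diff_of_simplicial (i' := i)) ?subrK //; last exact: (hP _ sc).1.
  rewrite -{1}(to_simplicialK c) [in LHS](hE _ sc) cycle_to_simplicial // raddf0 addr0.
  rewrite big1 ?add0r // => a _.
  rewrite ((pP a _ (ltn_ord a) sc).2 _ hc) ?mulr0z //.
  apply: contra il => /eqP E; apply/mapP; exists (nth 0%N l a); first exact: mem_nth.
  by rewrite -E opprB addrC subrK.
have [sz hz bz] := zP a al; set i0 := N%:Z - _.
have hz' : homog (N%:Z - i0) (z a) by rewrite opprB addrC subrK.
exists (of_simplicial i0 (z a)); split.
  by rewrite (diff_of_simplicial (i' := i0 + 1)) // bz raddf0.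
case=> b /(congr1 (@to_simplicial i0)).
rewrite of_simplicialK // to_simplicial_boundary => zE.
have := d a a al al; rewrite zE (pP a _ al (@to_simplicial_supp _ b)).1 eqxx.
by move/eqP; rewrite eq_sym oner_eq0.
Qed.

(** The generators in degree N - i are z a and z b, so their coordinates
    identify the homology group with the free group on them. *)
Lemma two_summands_extreme a b (i : int) :
  (a < size l)%N -> (b < size l)%N -> a != b ->
  i = N%:Z - (nth 0%N l a)%:Z -> nth 0%N l b = nth 0%N l a ->
  (forall c, (c < size l)%N -> nth 0%N l c = nth 0%N l a -> c = a \/ c = b) ->
  two_summands (extreme_homology D i).
Proof.
move=> al bl nab iE lbE only.
have [z [p [h [zP d pP hP hE]]]] := basis_l.
have Ni : N%:Z - i = (nth 0%N l a)%:Z by rewrite iE opprB addrC subrK.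
have [sa ha ba] := zP a al; have [sb hb bb] := zP b bl.
rewrite lbE in hb; rewrite -Ni in ha hb.
pose za : chain D i (jmax D) := of_simplicial i (z a).
pose zb : chain D i (jmax D) := of_simplicial i (z b).
have dza : diff (i + 1) za = 0 by rewrite (diff_of_simplicial (i' := i + 1)) // ba raddf0.
have dzb : diff (i + 1) zb = 0 by rewrite (diff_of_simplicial (i' := i + 1)) // bb raddf0.
have fP (x : int * int) : za *~ x.1 + zb *~ x.2 \in @is_cycle D i (jmax D).
  by rewrite unfold_in /is_cycle raddfD !raddfMz /= dza dzb !mul0rz addr0.
pose f x : extreme_homology D i :=
  (\pi_(homology D i (jmax D)) (Cycle (fP x)))%qT.
have f_zmod : zmod_morphism f.
  move=> x y; rewrite /f -raddfB; congr (\pi _)%qT; apply: val_inj => /=.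
  exact: mulrz_pairB.
pose fa : {additive int * int -> extreme_homology D i} :=
  HB.pack f (GRing.isZmodMorphism.Build _ _ f f_zmod).
pose coord c (q : extreme_homology D i) : int :=
  p c (to_simplicial (val (generic_quotient.repr (q : homology D i (jmax D)) : cycles D i (jmax D)))).
have p_boundary c (w : cycles D i (jmax D)) : (c < size l)%N ->
    w \in @is_boundary D i (jmax D) -> p c (to_simplicial (val w)) = 0.
  move=> cl /is_boundaryP[u ->]; rewrite to_simplicial_boundary.
  exact: (pP c _ cl (@to_simplicial_supp _ u)).1.
have coord_pi c (w : cycles D i (jmax D)) : (c < size l)%N ->
    coord c (\pi_(homology D i (jmax D)) w)%qT = p c (to_simplicial (val w)).
  move=> cl; rewrite /coord; set r := generic_quotient.repr _.
  apply/eqP; rewrite -subr_eq0 -!raddfB.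
  rewrite (p_boundary c (r - w)) // -pi_homology_eq0 raddfB /= reprK subrr //.
have toz : to_simplicial za = z a by rewrite of_simplicialK.
have tozb : to_simplicial zb = z b by rewrite of_simplicialK.
exists int, int, fa; split; try by exists 1.
exists (fun q => (coord a q, coord b q)) => [[x y]|q].
  rewrite /= /f !coord_pi //= raddfD !raddfMz /= toz tozb !raddfD !raddfMz /=.
  rewrite !d // eqxx (negbTE nab) eq_sym (negbTE nab) eqxx !mul0rz addr0 add0r.
  by rewrite /= ?mulr1n !intz.
rewrite /= /f -[RHS]reprK; apply/eqP; rewrite -subr_eq0 -raddfB pi_homology_eq0.
set w : cycles D i (jmax D) := generic_quotient.repr (q : homology D i (jmax D)).
have dw : diff (i + 1) (val w) = 0 by apply/eqP; exact: (valP w).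
have sw := @to_simplicial_supp _ (val w); have hw := @to_simplicial_homog _ (val w).
move: sw hw (cycle_to_simplicial dw); rewrite /coord -/w.
have := to_simplicialK (val w); move: (to_simplicial (val w)) => W WK sw hw bW.
have WE : W = z a *~ p a W + (z b *~ p b W + boundary ksign (h W)).
  rewrite {1}[W](hE _ sw) bW [h 0]raddf0 addr0 addrA; congr (_ + _).
  rewrite (bigD1 (Ordinal al)) //= (bigD1 (Ordinal bl)) /=; last first.
    by rewrite -(inj_eq val_inj) /= eq_sym.
  rewrite big1 ?addr0 // => c /andP[nca ncb].
  rewrite ((pP c _ (ltn_ord c) sw).2 _ hw) ?mulr0z //.
  rewrite Ni eqz_nat eq_sym; apply/eqP=> E.
  by have [/eqP|/eqP] := only c (ltn_ord c) E; [move: nca|move: ncb];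
    rewrite -(inj_eq val_inj) => /negbTE->.
have wE : val w = za *~ p a W + (zb *~ p b W + of_simplicial i (boundary ksign (h W))).
  rewrite -WK {1}WE (raddfD (of_simplicial i)) (raddfMz (of_simplicial i)).
  by rewrite (raddfD (of_simplicial i)) (raddfMz (of_simplicial i)).
apply/is_boundaryP; exists (of_simplicial (i - 1) (- h W)).
rewrite (diff_of_simplicial (i' := i)) ?subrK //; last exact/suppN/(hP _ sw).1.
rewrite (raddfN (boundary ksign)) (raddfN (of_simplicial i)).
apply: (addIr (val w)); rewrite [val (_ - w)]/(val _ - val w) subrK wE.
by rewrite addrC -!addrA subrr addr0.
Qed.

End Homology.

End Extreme.

(** * Chord diagrams given by intervals *)

Section Intervals.

Variables (T : finType) (lo hi : T -> nat) (side : T -> bool).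

Local Notation N := (2 * #|T|)%N.

Definition endpoint (x : T * bool) : nat := if x.2 then hi x.1 else lo x.1.

Definition crosses (t u : T) : bool :=
  (lo t < lo u < hi t)%N != (lo t < hi u < hi t)%N.

Hypothesis lo_hi : forall t, (lo t < hi t)%N.
Hypothesis hi_lt : forall t, (hi t < N)%N.
Hypothesis endpoint_inj : injective endpoint.
Hypothesis side_crosses : forall t u, crosses t u -> side t != side u.

Lemma endpoint_lt x : (endpoint x < N)%N.
Proof.
case: x => t []; rewrite /endpoint /=; first exact: hi_lt.
exact: ltn_trans (lo_hi t) (hi_lt t).
Qed.

Definition mark (x : T * bool) : 'I_N := Ordinal (endpoint_lt x).

Lemma mark_inj : injective mark.
Proof. by move=> x y /(congr1 val) /endpoint_inj. Qed.

(** There are as many chord ends as points, so every point below N is the end of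
    a chord. *)
Lemma mark_onto y : y \in codom mark.
Proof. by apply: inj_card_onto mark_inj _ _; rewrite card_prod card_bool !card_ord mulnC. Qed.

Definition chord_at (y : 'I_N) : T * bool := iinv (mark_onto y).

Lemma chord_atK : cancel chord_at mark. Proof. by move=> y; apply: f_iinv. Qed.
Lemma markK : cancel mark chord_at. Proof. by move=> x; apply: mark_inj; apply: chord_atK. Qed.

Definition other_end (y : 'I_N) : 'I_N :=
  mark ((chord_at y).1, ~~ (chord_at y).2).

Lemma other_end_mark x : other_end (mark x) = mark (x.1, ~~ x.2).
Proof. by rewrite /other_end markK. Qed.

Lemma other_endK : involutive other_end.
Proof. by move=> y; rewrite -[y]chord_atK !other_end_mark /= negbK -surjective_pairing. Qed.

Definition inner_at (y : 'I_N) : bool := side (chord_at y).1.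

Lemma inner_other_end y : inner_at (other_end y) = inner_at y.
Proof. by rewrite /inner_at /other_end markK. Qed.

Lemma interlaced_mark x y : interlaced other_end (mark x) (mark y) = crosses x.1 y.1.
Proof.
rewrite /interlaced !other_end_mark /crosses /=; case: x => t b; case: y => u c.
have := lo_hi t; have := lo_hi u; rewrite /endpoint /=.
move: (lo t) (hi t) (lo u) (hi u) => lt ht lu hu.
by case: b; case: c => /=; lia.
Qed.

Lemma inner_interlaced_at y z : interlaced other_end y z -> inner_at y != inner_at z.
Proof.
rewrite -[y]chord_atK -[z]chord_atK interlaced_mark /inner_at !markK.
exact: side_crosses.
Qed.

Hypothesis T_gt0 : (0 < #|T|)%N.

Lemma two_card_gt0 : (0 < N)%N. Proof. by rewrite muln_gt0. Qed.

Definition interval_link : link_diagram :=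
  chord_link two_card_gt0 other_endK inner_other_end inner_interlaced_at.

Definition lows : {set 'I_N} := [set mark (t, false) | t : T].

(** The two copies of a chord are interlaced with the same crossings, so the
    copy at the upper end can be deleted by [homology_basis_twin]. *)
Lemma homology_basis_lows l :
  homology_basis (interlaced other_end) (@ksign N) lows l ->
  homology_basis (interlaced other_end) (@ksign N) setT l.
Proof.
move=> Hl; suff H s : uniq s ->
    homology_basis (interlaced other_end) (@ksign N) ([set mark (t, true) | t in s] :|: lows) l.
  have -> : setT = [set mark (t, true) | t in enum T] :|: lows.
    apply/setP=> y; rewrite inE -[y]chord_atK; symmetry; apply/setUP.
    case: (chord_at y) => t []; [left|right]; apply/imsetP; exists t => //.
    by rewrite mem_enum.
  by apply: H; apply: enum_uniq.
elim: s => [_|t s IH /= /andP[ts us]].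
  by have -> : [set mark (t, true) | t in [::]] :|: lows = lows;
    [apply/setP=> y; rewrite inE; case: imsetP => // -[] | ].
have neq u : (mark (t, true) == mark (u, false)) = false.
  by apply/eqP => /mark_inj.
apply: (@homology_basis_twin _ _ _ _ _ _ _ (mark (t, true)) (mark (t, false))).
- exact: ksign_sq.
- exact: ksign_anti.
- exact: interlaced_sym other_endK.
- exact: interlaced_irr.
- by apply/setUP; left; apply/imsetP; exists t; rewrite ?inE ?eqxx.
- by apply/setUP; right; apply/imsetP; exists t.
- by rewrite neq.
- by move=> y; rewrite -[y]chord_atK !interlaced_mark.
suff -> : ([set mark (t, true) | t in t :: s] :|: lows) :\ mark (t, true)
    = [set mark (t, true) | t in s] :|: lows by apply: IH.
apply/setP=> y; rewrite in_setD1 [LHS]/= !in_setU.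
apply/andP/orP=> [[nyt /orP[/imsetP[u us' yE]|->]]|[/imsetP[u us' ->]|yl]]; rewrite ?orbT; auto.
- left; apply/imsetP; exists u => //; move: us'; rewrite inE => /orP[/eqP E|//].
  by move: nyt; rewrite yE E eqxx.
- split; last by apply/orP; left; apply/imsetP; exists u; rewrite // inE us' orbT.
  by apply: contraNneq ts => /mark_inj [<-].
- split; last by rewrite yl orbT.
  by case/imsetP: yl => u _ ->; rewrite eq_sym neq.
Qed.

End Intervals.

Section FlowerIntervals.

(** A flower with a petals occupies the points from o to o + 10 a, except for
    the second end of its centre.  Writing x0, ..., x4 for the chords of a petal,
    one reads x4 x0 for the petals a - 1, ..., 0, then the first end of the
    centre, then x1 x0 x2 x1 x3 x2 x4 x3 for the petals 0, ..., a - 1.  The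
    chords x0 and x4 of all petals are nested around the first end of the centre;
    they alone cross the centre, whose second end h lies beyond the block. *)
Definition petal_lo (o a j k : nat) : nat :=
  match k with
  | 0 => o + 2 * (a - 1 - j) + 1
  | 1 => o + 2 * a + 1 + 8 * j
  | 2 => o + 2 * a + 1 + 8 * j + 2
  | 3 => o + 2 * a + 1 + 8 * j + 4
  | _ => o + 2 * (a - 1 - j)
  end%N.

Definition petal_hi (o a j k : nat) : nat :=
  (o + 2 * a + 1 + 8 * j + nth 0 [:: 1; 3; 5; 7; 6] k)%N.

Definition flower (a : nat) : finType := option ('I_a * 'I_5).

Variables (a : nat) (o h : nat) (s : bool).

Definition flower_lo (t : flower a) : nat :=
  if t is Some (j, k) then petal_lo o a j k else (o + 2 * a)%N.
Definition flower_hi (t : flower a) : nat :=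
  if t is Some (j, k) then petal_hi o a j k else h.
Definition flower_side (t : flower a) : bool :=
  if t is Some (j, k) then odd k == s else s.

Lemma card_flower : #|flower a| = (5 * a).+1.
Proof. by rewrite card_option card_prod !card_ord mulnC. Qed.

Definition flower_adj (t u : flower a) : bool :=
  match t, u with
  | None, None => false
  | None, Some (j, k) | Some (j, k), None => (k == 0 :> nat) || (k == 4 :> nat)
  | Some (j, k), Some (j', k') =>
      (j == j') && ((k == k'.+1 :> nat) || (k' == k.+1 :> nat))
  end.

Hypothesis h_gt : (o + 10 * a < h)%N.

Lemma flower_lo_hi t : (flower_lo t < flower_hi t)%N.
Proof.
case: t => [[j [k]]|] /=; last by lia.
by case: k => [|[|[|[|[|//]]]]] _; rewrite /petal_lo /petal_hi /=; have := ltn_ord j; lia.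
Qed.

Lemma flower_crosses t u : crosses flower_lo flower_hi t u = flower_adj t u.
Proof.
case: t => [[j [k ltk]]|]; case: u => [[j' [k' ltk']]|]; rewrite /crosses /=.
- rewrite -(inj_eq val_inj) /=; have := ltn_ord j; have := ltn_ord j'.
  move: (nat_of_ord j) (nat_of_ord j') => i i' {j j'}.
  case: k ltk => [|[|[|[|[|//]]]]] _; case: k' ltk' => [|[|[|[|[|//]]]]] _;
    rewrite /petal_lo /petal_hi /=; lia.
- have := ltn_ord j; case: k ltk => [|[|[|[|[|//]]]]] _; rewrite /petal_lo /petal_hi /=; lia.
- have := ltn_ord j'; case: k' ltk' => [|[|[|[|[|//]]]]] _; rewrite /petal_lo /petal_hi /=; lia.
- lia.
Qed.

(** The flower is a bipartite graph, so neighbours can be drawn on different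
    sides of the circle. *)
Lemma flower_side_adj t u : flower_adj t u -> flower_side t != flower_side u.
Proof.
case: t => [[j k]|]; case: u => [[j' k']|] //=.
- case/andP=> _; case: (s) => /orP[]/eqP-> /=; by case: odd.
- by case: s => /orP[]/eqP->.
- by case: s => /orP[]/eqP->.
Qed.

Lemma endpoint_flower_range (x : flower a * bool) :
  x != (None, true) ->
  (o <= endpoint flower_lo flower_hi x < o + 10 * a + 1)%N.
Proof.
case: x => -[[j [k ltk]]|] [] // _; rewrite /endpoint /=; try lia;
  have := ltn_ord j; case: k ltk => [|[|[|[|[|//]]]]] _; rewrite /petal_lo /petal_hi /=; lia.
Qed.

Lemma petal_end_inj j k j' k' (b c : bool) :
  (j < a)%N -> (j' < a)%N -> (k < 5)%N -> (k' < 5)%N ->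
  (if b then petal_hi o a j k else petal_lo o a j k) =
  (if c then petal_hi o a j' k' else petal_lo o a j' k') ->
  [/\ j = j', k = k' & b = c].
Proof.
move=> ja j'a; case: k => [|[|[|[|[|//]]]]] _; case: k' => [|[|[|[|[|//]]]]] _;
  case: b; case: c; rewrite /petal_lo /petal_hi /= => E;
  by [exfalso; lia | split=> //; lia].
Qed.

Lemma endpoint_flower_inj : injective (endpoint flower_lo flower_hi).
Proof.
move=> -[[[j [k ltk]]|] b] [[[j' [k' ltk']]|] c]; rewrite /endpoint /=.
- move=> /(petal_end_inj (ltn_ord j) (ltn_ord j') ltk ltk')[jj kk ->].
  by congr (Some (_, _), _); apply: val_inj.
- move=> E; exfalso; move: E; have := ltn_ord j; case: b; case: c => /=; case: k ltk => [|[|[|[|[|//]]]]] _;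
    rewrite /petal_lo /petal_hi /=; lia.
- move=> E; exfalso; move: E; have := ltn_ord j'; case: b; case: c => /=; case: k' ltk' => [|[|[|[|[|//]]]]] _;
    rewrite /petal_lo /petal_hi /=; lia.
- by case: b; case: c => //= E; exfalso; lia.
Qed.

End FlowerIntervals.

(** * One flower *)

Section FlowerHomology.

Variables (V : finType) (e : rel V) (eps : V -> {set V} -> int).
Hypothesis eps_sq : forall v (T : {set V}), eps v T * eps v T = 1.
Hypothesis eps_anti : forall u v (T : {set V}), u != v -> u \notin T -> v \notin T ->
  eps v (u |: T) * eps u T = - (eps u (v |: T) * eps v T).
Hypothesis e_sym : symmetric e.
Hypothesis e_irr : irreflexive e.

Variables (a : nat) (mu : flower a -> V).
Hypothesis mu_inj : injective mu.
Hypothesis mu_adj : forall t u, e (mu t) (mu u) = flower_adj t u.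

Let P (j : 'I_a) (k : nat) : V := mu (Some (j, inord k)).

Lemma inord5_eq k k' : (k < 5)%N -> (k' < 5)%N ->
  ((inord k : 'I_5) == inord k') = (k == k').
Proof. by move=> k5 k'5; rewrite -(inj_eq val_inj) /= !inordK. Qed.

Lemma P_inj j k j' k' : (k < 5)%N -> (k' < 5)%N ->
  (P j k == P j' k') = (j == j') && (k == k').
Proof.
move=> k5 k'5; rewrite (inj_eq mu_inj) -[_ == _]/((j, inord k) == (j', inord k')).
by rewrite xpair_eqE inord5_eq.
Qed.

Lemma P_adj j k j' k' : (k < 5)%N -> (k' < 5)%N ->
  e (P j k) (P j' k') = (j == j') && ((k == k'.+1) || (k' == k.+1)).
Proof. by move=> k5 k'5; rewrite mu_adj /= !inordK. Qed.

Lemma petals_enum : petals P 0 5 (enum 'I_a) = [set mu (Some x) | x : 'I_a * 'I_5].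
Proof.
apply/setP=> y; apply/petalsP/imsetP=> [[j [k [_ k5 ->]]]|[[j k] _ ->]].
  by exists (j, inord k).
by exists j, k; rewrite mem_enum ltn_ord /P inord_val.
Qed.

Variable Z : {set V}.
Hypothesis Z_disjoint : forall t z, z \in Z -> z != mu t.
Hypothesis Z_apart : forall x z, z \in Z -> ~~ e (mu (Some x)) z.

Let PZ : apart e P Z.
Proof. by move=> j k z _ zZ; rewrite Z_disjoint //= Z_apart. Qed.

Lemma homology_basis_all_petals l :
  homology_basis e eps Z l ->
  homology_basis e eps ([set mu (Some x) | x : 'I_a * 'I_5] :|: Z) (map (addn (2 * a)) l).
Proof.
move=> HZ; rewrite -petals_enum.
have := homology_basis_petals eps_sq eps_anti e_sym e_irr P_inj P_adj
  (enum_uniq 'I_a) PZ HZ.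
by rewrite size_enum_ord.
Qed.

Lemma homology_basis_whole_flower l1 l2 : (0 < a)%N ->
  homology_basis e eps Z l1 ->
  homology_basis e eps [set z in Z | ~~ e (mu None) z] l2 ->
  homology_basis e eps ([set mu t | t : flower a] :|: Z)
    (map (addn (2 * a)) l1 ++ map S (map (addn a) l2)).
Proof.
move=> a0 H1 H2.
have -> : [set mu t | t : flower a] :|: Z = mu None |: (petals P 0 5 (enum 'I_a) :|: Z).
  rewrite petals_enum setUA; congr (_ :|: _); apply/setP=> y; rewrite in_setU1.
  apply/imsetP/orP=> [[[x|] _ ->]|[/eqP->|/imsetP[x _ ->]]]; [right|left|..] => //.
  - by apply: imset_f.
  - by exists None.
  - by exists (Some x).
have := @homology_basis_flower V e eps eps_sq eps_anti e_sym e_irr _ P P_inj P_adj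
  (mu None) Z (enum 'I_a) l1 l2.
rewrite size_enum_ord; apply=> //.
- by rewrite -size_eq0 size_enum_ord -lt0n.
- exact: enum_uniq.
- by apply/negP=> /(Z_disjoint None); rewrite eqxx.
- by move=> j k k5; rewrite (inj_eq mu_inj) mu_adj /= inordK // !inE.
Qed.

End FlowerHomology.

Definition one_lo a (t : flower a) : nat := flower_lo 0 t.
Definition one_hi a (t : flower a) : nat := flower_hi 0 (10 * a + 1) t.

Section OneFlower.

Variable a : nat.
Let h_gt : (0 + 10 * a < 10 * a + 1)%N. Proof. lia. Qed.

Lemma one_card : (0 < #|flower a|)%N. Proof. by rewrite card_flower. Qed.

Lemma one_lo_hi (t : flower a) : (one_lo t < one_hi t)%N.
Proof. exact: flower_lo_hi. Qed.

Lemma one_hi_lt (t : flower a) : (one_hi t < 2 * #|flower a|)%N.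
Proof.
rewrite card_flower; case: t => [x|]; last by rewrite /one_hi /=; lia.
have := endpoint_flower_range h_gt (x := (Some x, true)) isT.
by rewrite /endpoint /=; lia.
Qed.

Lemma one_inj : injective (endpoint (@one_lo a) (@one_hi a)).
Proof. exact: endpoint_flower_inj. Qed.

Lemma one_side (t u : flower a) : crosses (@one_lo a) (@one_hi a) t u ->
  flower_side true t != flower_side true u.
Proof. by rewrite flower_crosses //; apply: flower_side_adj. Qed.

Definition one_flower_link : link_diagram :=
  interval_link one_lo_hi one_hi_lt one_inj one_side one_card.

Hypothesis a_gt0 : (0 < a)%N.

Lemma one_flower_homology :
  homology_basis (interlaced (other_end one_lo_hi one_hi_lt one_inj))
    (@ksign (2 * #|flower a|)) setT [:: 2 * a; a.+1]%N.
Proof.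
apply: homology_basis_lows.
rewrite -[lows _ _]setU0.
have H0 : homology_basis (interlaced (other_end one_lo_hi one_hi_lt one_inj))
    (@ksign (2 * #|flower a|)) set0 [:: 0%N] by apply: homology_basis_set0.
have := @homology_basis_whole_flower _ _ _ (@ksign_sq _) (@ksign_anti _)
  (interlaced_sym (other_endK _ _ _)) (@interlaced_irr _ _) a
  (fun t => mark one_lo_hi one_hi_lt (t, false)) _ _ set0 _ _ [:: 0%N] [:: 0%N].
rewrite /= !addn0; apply=> //.
- by move=> t u /(mark_inj one_inj)[].
- by move=> t u; rewrite interlaced_mark flower_crosses.
- by move=> t z; rewrite inE.
- by move=> t z; rewrite inE.
- by have -> : [set z in set0 | ~~ _ z] = set0 :> {set 'I_(2 * #|flower a|)}; [move=> ?; apply/setP=> z; rewrite !inE|].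
Qed.

End OneFlower.

(** * Two flowers *)

Section TwoFlowers.

Variables a b : nat.

Definition two_flowers : finType := (flower a + flower b)%type.

(** Two flower blocks in a row, followed by the second ends of the centres in
    the same order as the first ones, so that the centres are interlaced. *)
Definition two_lo (t : two_flowers) : nat :=
  match t with inl x => flower_lo 0 x | inr y => flower_lo (10 * a + 1) y end.
Definition two_hi (t : two_flowers) : nat :=
  match t with
  | inl x => flower_hi 0 (10 * a + 10 * b + 2) x
  | inr y => flower_hi (10 * a + 1) (10 * a + 10 * b + 3) y
  end.
Definition two_side (t : two_flowers) : bool :=
  match t with inl x => flower_side true x | inr y => flower_side false y end.

Let h1_gt : (0 + 10 * a < 10 * a + 10 * b + 2)%N. Proof. lia. Qed.
Let h2_gt : (10 * a + 1 + 10 * b < 10 * a + 10 * b + 3)%N. Proof. lia. Qed.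

Lemma two_card : (0 < #|two_flowers|)%N. Proof. by rewrite card_sum !card_flower. Qed.

Lemma two_lo_hi t : (two_lo t < two_hi t)%N.
Proof. by case: t => t; apply: flower_lo_hi. Qed.

Lemma two_ends_left (x : 'I_a * 'I_5) :
  (two_lo (inl (Some x)) < 10 * a + 1)%N /\ (two_hi (inl (Some x)) < 10 * a + 1)%N.
Proof.
have := endpoint_flower_range h1_gt (x := (Some x, false)) isT.
have := endpoint_flower_range h1_gt (x := (Some x, true)) isT.
by rewrite /endpoint /=; lia.
Qed.

Lemma two_ends_right (y : 'I_b * 'I_5) :
  (10 * a + 1 <= two_lo (inr (Some y)) < 10 * a + 10 * b + 2)%N /\
  (10 * a + 1 <= two_hi (inr (Some y)) < 10 * a + 10 * b + 2)%N.
Proof.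
have := endpoint_flower_range h2_gt (x := (Some y, false)) isT.
have := endpoint_flower_range h2_gt (x := (Some y, true)) isT.
by rewrite /endpoint /=; lia.
Qed.

Lemma two_hi_lt t : (two_hi t < 2 * #|two_flowers|)%N.
Proof.
rewrite card_sum !card_flower; case: t => [[x|]|[y|]].
- by have [_] := two_ends_left x; move: (two_hi _) => k; lia.
- by rewrite /=; lia.
- by have [_] := two_ends_right y; move: (two_hi _) => k; lia.
- by rewrite /=; lia.
Qed.

Lemma two_inj : injective (endpoint two_lo two_hi).
Proof.
have mixed (x : flower a) (y : flower b) c d :
    endpoint two_lo two_hi (inl x, c) != endpoint two_lo two_hi (inr y, d).
  rewrite /endpoint /=; case: x => [x|]; case: y => [y|];
    try have := two_ends_left x; try have := two_ends_right y; rewrite /=;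
    case: c; case: d => /=; lia.
move=> [[x|x] c] [[y|y] d] E.
- by have [-> ->] := @endpoint_flower_inj a 0 _ h1_gt (x, c) (y, d) E.
- by have := mixed x y c d; rewrite E eqxx.
- by have := mixed y x d c; rewrite E eqxx.
- by have [-> ->] := @endpoint_flower_inj b _ _ h2_gt (x, c) (y, d) E.
Qed.

Lemma two_crosses_left x y : crosses two_lo two_hi (inl x) (inl y) = flower_adj x y.
Proof. exact: (flower_crosses h1_gt x y). Qed.

Lemma two_crosses_right x y : crosses two_lo two_hi (inr x) (inr y) = flower_adj x y.
Proof. exact: (flower_crosses h2_gt x y). Qed.

Lemma two_crosses_mixed x y :
  crosses two_lo two_hi (inl x) (inr y) = ~~ isSome x && ~~ isSome y.
Proof.
have lx := two_lo_hi (inl x); have ly := two_lo_hi (inr y).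
rewrite /crosses; move: lx ly; case: x => [x|]; case: y => [y|];
  try have := two_ends_left x; try have := two_ends_right y; rewrite /=; lia.
Qed.

Lemma two_crosses_mixed_sym x y :
  crosses two_lo two_hi (inr y) (inl x) = ~~ isSome x && ~~ isSome y.
Proof.
have lx := two_lo_hi (inl x); have ly := two_lo_hi (inr y).
rewrite /crosses; move: lx ly; case: x => [x|]; case: y => [y|];
  try have := two_ends_left x; try have := two_ends_right y; rewrite /=; lia.
Qed.

Lemma two_sides t u : crosses two_lo two_hi t u -> two_side t != two_side u.
Proof.
case: t => x; case: u => y.
- by rewrite two_crosses_left; apply: flower_side_adj.
- by rewrite two_crosses_mixed ; case: x; case: y.
- by rewrite two_crosses_mixed_sym ; case: x; case: y.
- by rewrite two_crosses_right; apply: flower_side_adj.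
Qed.

Definition two_flower_link : link_diagram :=
  interval_link two_lo_hi two_hi_lt two_inj two_sides two_card.

Hypothesis a_gt0 : (0 < a)%N.
Hypothesis b_gt0 : (0 < b)%N.

Local Notation adj := (interlaced (other_end two_lo_hi two_hi_lt two_inj)).
Local Notation sign := (@ksign (2 * #|two_flowers|)).
Local Notation left t := (mark two_lo_hi two_hi_lt (inl t, false)).
Local Notation right t := (mark two_lo_hi two_hi_lt (inr t, false)).

(** Split at the centre of the second flower.  Deleting it leaves the first
    flower beside the petals of the second one; deleting also its neighbours
    removes the centre of the first flower and leaves the petals of that flower
    beside the cores of the second one. *)
Lemma two_flower_homology : homology_basis adj sign setT
  [:: 2 * b + 2 * a; 2 * b + a.+1; (b + 2 * a).+1]%N.
Proof.
have adj_sym := interlaced_sym (other_endK two_lo_hi two_hi_lt two_inj).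
have adj_irr := @interlaced_irr _ (other_end two_lo_hi two_hi_lt two_inj).
have left_inj : injective (fun t => left t) by move=> t u /(mark_inj two_inj)[].
have right_inj : injective (fun t => right t) by move=> t u /(mark_inj two_inj)[].
have left_adj t u : adj (left t) (left u) = flower_adj t u.
  by rewrite interlaced_mark two_crosses_left.
have right_adj t u : adj (right t) (right u) = flower_adj t u.
  by rewrite interlaced_mark two_crosses_right.
have mixed_adj t u : adj (right u) (left t) = ~~ isSome t && ~~ isSome u.
  by rewrite interlaced_mark two_crosses_mixed_sym.
have H0 : homology_basis adj sign set0 [:: 0%N] by apply: homology_basis_set0.
have H0' v : homology_basis adj sign [set z in set0 | ~~ adj v z] [:: 0%N].
  by have -> : [set z in set0 | ~~ adj v z] = set0 by apply/setP=> z; rewrite !inE.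
have out0 (z y : 'I_(2 * #|two_flowers|)) : z \in set0 -> z != y by rewrite inE.
have out0' (z y : 'I_(2 * #|two_flowers|)) : z \in set0 -> ~~ adj y z by rewrite inE.
have HP := @homology_basis_all_petals _ adj sign (@ksign_sq _) (@ksign_anti _) adj_sym adj_irr a
  (fun t => left t) left_inj left_adj set0 (fun t z => @out0 z _) (fun t z => @out0' z _) _ H0.
have HF := @homology_basis_whole_flower _ adj sign (@ksign_sq _) (@ksign_anti _) adj_sym adj_irr a
  (fun t => left t) left_inj left_adj set0 (fun t z => @out0 z _) (fun t z => @out0' z _)
  _ _ a_gt0 H0 (H0' _).
move: HP HF; rewrite !setU0 /= !addn0 => HP HF.
apply: homology_basis_lows.
have -> : lows two_lo_hi two_hi_lt
    = [set right t | t : flower b] :|: [set left t | t : flower a].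
  apply/setP=> y; apply/imsetP/setUP=> [[[t|t] _ ->]|[/imsetP[t _ ->]|/imsetP[t _ ->]]].
  - by right; apply: (imset_f (fun t => left t)).
  - by left; apply: (imset_f (fun t => right t)).
  - by exists (inr t).
  - by exists (inl t).
have := @homology_basis_whole_flower _ adj sign (@ksign_sq _) (@ksign_anti _) adj_sym adj_irr b
  (fun t => right t) right_inj right_adj [set left t | t : flower a] _ _ _ [:: 2 * a]%N b_gt0 HF.
rewrite /=; apply=> [t z /imsetP[u _ ->]|x z /imsetP[u _ ->]|].
- by apply/eqP=> /(mark_inj two_inj).
- by rewrite mixed_adj andbF.
suff -> : [set z in [set left t | t : flower a] | ~~ adj (right None) z]
    = [set left (Some x) | x : 'I_a * 'I_5] by [].
apply/setP=> z; rewrite inE; apply/andP/imsetP=> [[/imsetP[[x|] _ ->]]|[x _ ->]].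
- by exists x.
- by rewrite mixed_adj.
- by rewrite mixed_adj; split=> //; apply: (imset_f (fun t => left t)).
Qed.

End TwoFlowers.

Theorem theorem7p9 :
  (forall n : int, 0 < n ->
    exists (D : link_diagram) (i1 i2 : int),
      [/\ is_knot D,
          forall i : int, nontrivial (extreme_homology D i) <->
            (i = i1 \/ i = i2),
          i1 = i2 -> two_summands (extreme_homology D i1)
        & i1 - i2 = n - 1])
  /\
  (forall m n : int, 0 < m -> 0 < n ->
    exists (D : link_diagram) (i1 i2 i3 : int),
      [/\ is_knot D,
          forall i : int, nontrivial (extreme_homology D i) <->
            [\/ i = i1, i = i2 | i = i3],
          i1 = i2 -> two_summands (extreme_homology D i1),
          i1 - i2 = m - 1
        & i2 - i3 = n]).
Proof.
split=> [[n|//] n_gt0|[m|//] [n|//] m_gt0 n_gt0].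
  have H := one_flower_homology n_gt0; pose N := (2 * #|flower n|)%N.
  exists (one_flower_link n), (N%:Z - n.+1%:Z), (N%:Z - (2 * n)%N%:Z); split.
  - exact: chord_link_knot.
  - move=> i; rewrite (nontrivial_extreme _ _ _ _ H i) !inE.
    by split=> [/orP[]/eqP|[]] ->; rewrite ?eqxx ?orbT; auto.
  - move=> E; have n1 : n = 1%N by lia.
    apply: (two_summands_extreme _ _ _ _ H (a := 1) (b := 0)) => //=.
      by rewrite n1.
    by move=> [|[|//]] _ _; [right|left].
  - lia.
(* The gaps between the three degrees are b - a = m - 1 and a - 1 = n. *)
pose a := n.+1; pose b := (m + n)%N.
have a_gt0 : (0 < a)%N by [].
have b_gt0 : (0 < b)%N by lia.
have H := two_flower_homology a_gt0 b_gt0; pose N := (2 * #|two_flowers a b|)%N.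
exists (two_flower_link a b), (N%:Z - (b + 2 * a).+1%:Z),
  (N%:Z - (2 * b + a.+1)%N%:Z), (N%:Z - (2 * b + 2 * a)%N%:Z); split.
- exact: chord_link_knot.
- move=> i; rewrite (nontrivial_extreme _ _ _ _ H i) !inE.
  by split=> [/or3P[]/eqP|[]] ->; rewrite ?eqxx ?orbT; [constructor 3|constructor 2|constructor 1|..].
- move=> E; have m1 : m = 1%N by lia.
  apply: (two_summands_extreme _ _ _ _ H (a := 2) (b := 1)) => //=; first by lia.
  by move=> [|[|[|//]]] _ /= E'; [exfalso; lia|right|left].
- lia.
- lia.
Qed.
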